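(* Let $k$ be the number of memory hierarchies of the blocking scheme. There is a dynamic-programming algorithm that, given an alphabet $C$ of $n$ characters with frequencies, the blocking scheme, a permitted code length $\mathcal{L}$ and $\epsilon,\delta>0$, returns a prefix tree $T$ with $\mathrm{len}(T)\le(1+\epsilon)(1+\delta)\mathcal{L}$ and $\Delta(T)\le(1+\delta)\,\mathrm{DOPT}(\mathcal{L})$, in time $O\!\left(\frac{n^2 k^2\log^2 n}{\epsilon\,\delta^2}\right)$; in particular, when $k$ is a constant, the running time is $O\!\left(\frac{n^2\log^2 n}{\epsilon\,\delta^2}\right)$.
   Context: Let $C$ be an alphabet of $n$ characters, each $c\in C$ with a nonnegative integer frequency $\mathrm{freq}(c)$. A prefix tree for $C$ is a rooted binary tree in which every internal node has exactly two children and whose leaves are in bijection with $C$; $d_T(c)$ is the depth of the leaf of $c$ (root has depth $0$). The code length of $T$ is $\mathrm{len}(T)=\sum_{c\in C}\mathrm{freq}(c)\, d_T(c)$. A blocking scheme is a sequence $BS=\langle (w_1,q_1),\dots,(w_m,q_m)\rangle$ of positive integer widths $w_j$ and access costs $q_j\ge0$ (assumed long enough that the quantities below exist). Its number of memory hierarchies is $k(BS)=1+|\{i\in[2,m]: q_i\ne q_{i-1}\}|$. For a character $c$, let $W_T(c)$ be the smallest $h$ with $\sum_{j=1}^h w_j\ge d_T(c)$, and $\Delta_T(c)=\sum_{i\le W_T(c)} q_i$. The decode time of $T$ is $\Delta(T)=\sum_{c\in C}\mathrm{freq}(c)\,\Delta_T(c)$. $\mathrm{DOPT}(\mathcal{L})$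 denotes the minimum of $\Delta(T)$ over all prefix trees $T$ with $\mathrm{len}(T)\le\mathcal{L}$.
   Formalization: The running-time bounds are stated for n ≥ 2 and for ε, δ at most an arbitrary fixed bound B, with the O-constant depending on B, since the literal bound is 0 at n = 1 and tends to 0 as ε or δ grows; correctness is for all ε, δ > 0 whenever some prefix tree has length at most L. *)

(* Defs.v *)
From HB Require Import structures.
From mathcomp Require Import all_boot all_order all_algebra.
From mathcomp Require Import reals exp.

Set Implicit Arguments.
Unset Strict Implicit.
Unset Printing Implicit Defensive.

Import Order.TTheory GRing.Theory Num.Theory.
Local Open Scope ring_scope.

Inductive tree (n : nat) : Type :=
| Leaf of 'I_n
| Node of tree n & tree n.

Fixpoint leaves (n : nat) (T : tree n) : seq 'I_n :=
  match T with
  | Leaf c => [:: c]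
  | Node l r => leaves l ++ leaves r
  end.

Definition prefix_tree (n : nat) (T : tree n) : Prop :=
  perm_eq (leaves T) (enum 'I_n).

(* Meaningful only when c labels exactly one leaf of T. *)
Fixpoint depth (n : nat) (T : tree n) (c : 'I_n) : nat :=
  match T with
  | Leaf _ => 0
  | Node l r => (if c \in leaves l then depth l c else depth r c).+1
  end%N.

Definition len (n : nat) (freq : 'I_n -> nat) (T : tree n) : nat :=
  (\sum_(c < n) freq c * depth T c)%N.

(* The blocks (w_j, q_j) are numbered from 0. *)
Definition scheme (R : realType) : Type := seq (nat * R).

Definition width (R : realType) (bs : scheme R) (j : nat) : nat :=
  (nth (0%N, 0) bs j).1.

Definition acost (R : realType) (bs : scheme R) (j : nat) : R :=
  (nth (0%N, 0) bs j).2.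

Definition hierarchies (R : realType) (bs : scheme R) : nat :=
  (1 + \sum_(1 <= i < size bs) (acost bs i != acost bs i.-1))%N.

(* The smallest h <= m such that the first h blocks cover depth d; the value is
   (size bs).+1, and meaningless, if there is none. *)
Definition nblocks (R : realType) (bs : scheme R) (d : nat) : nat :=
  find (fun h => d <= \sum_(j < h) width bs j)%N (iota 0 (size bs).+1).

Definition decode_char (R : realType) (bs : scheme R) (n : nat) (T : tree n)
    (c : 'I_n) : R :=
  \sum_(i < nblocks bs (depth T c)) acost bs i.

Definition decode_time (R : realType) (bs : scheme R) (n : nat)
    (freq : 'I_n -> nat) (T : tree n) : R :=
  \sum_(c < n) (freq c)%:R * decode_char bs T c.

Record instance (R : realType) : Type := Instance {
  nchars : nat;
  freq : 'I_nchars -> nat;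
  bscheme : scheme R;
  codelen : R;
  eps : R;
  delta : R }.

Arguments freq {R} i _.

Definition feasible (R : realType) (x : instance R) (T : tree (nchars x)) :
    Prop :=
  prefix_tree T /\ (len (freq x) T)%:R <= codelen x.

Arguments feasible {R} x T.

Definition is_DOPT (R : realType) (x : instance R) (D : R) : Prop :=
  (exists T, feasible x T /\ decode_time (bscheme x) (freq x) T = D)
  /\ (forall T, feasible x T ->
        D <= decode_time (bscheme x) (freq x) T).

(* The last two clauses say that all W_T(c) exist and that the minimum
   DOPT(L) ranges over a nonempty set. *)
Definition admissible (R : realType) (x : instance R) : Prop :=
  [/\ 0 < eps x,
      0 < delta x,
      forall j, (j < size (bscheme x))%N ->
        (0 < width (bscheme x) j)%N /\ 0 <= acost (bscheme x) j,
      forall (T : tree (nchars x)) (c : 'I_(nchars x)), prefix_tree T ->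
        (depth T c <= \sum_(j < size (bscheme x)) width (bscheme x) j)%N
    & exists T, feasible x T].

(** A unit-cost real RAM.  Programs are finite syntax trees that work on arrays of naturals and arrays
    of reals.  Array names are literals of the program, so that a program uses
    finitely many arrays, each unbounded; entry i of array a is addressed by a
    computed index i.  Scalar variables are array entries with a constant
    index.  As usual for the real RAM, the real operations are the four
    field operations, comparison and conversion from naturals, and there is no
    rounding; the only literals are natural numbers.  Every elementary
    operation, memory access and test costs one time unit. *)

Inductive iexp : Type :=
| ICst of nat
| IGet of nat & iexp
| IAdd of iexp & iexp
| ISub of iexp & iexp
| IMul of iexp & iexp.

Inductive rexp : Type :=
| RCst of nat
| RGet of nat & iexp
| ROfI of iexp
| RAdd of rexp & rexp
| RSub of rexp & rexp
| RMul of rexp & rexp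
| RDiv of rexp & rexp.

Inductive test : Type :=
| TILe of iexp & iexp
| TRLe of rexp & rexp.

Inductive program : Type :=
| Skip
| ISet of nat & iexp & iexp
| RSet of nat & iexp & rexp
| Seq of program & program
| If of test & program & program
| While of test & program.

Record state (R : realType) : Type := State {
  iarr : nat -> nat -> nat;
  rarr : nat -> nat -> R }.

Fixpoint ieval (R : realType) (s : state R) (e : iexp) : nat :=
  match e with
  | ICst k => k
  | IGet a e1 => iarr s a (ieval s e1)
  | IAdd e1 e2 => ieval s e1 + ieval s e2
  | ISub e1 e2 => ieval s e1 - ieval s e2
  | IMul e1 e2 => ieval s e1 * ieval s e2
  end%N.

Fixpoint reval (R : realType) (s : state R) (e : rexp) : R :=
  match e with
  | RCst k => k%:R
  | RGet a e1 => rarr s a (ieval s e1)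
  | ROfI e1 => (ieval s e1)%:R
  | RAdd e1 e2 => reval s e1 + reval s e2
  | RSub e1 e2 => reval s e1 - reval s e2
  | RMul e1 e2 => reval s e1 * reval s e2
  | RDiv e1 e2 => reval s e1 / reval s e2
  end.

Definition teval (R : realType) (s : state R) (b : test) : bool :=
  match b with
  | TILe e1 e2 => (ieval s e1 <= ieval s e2)%N
  | TRLe e1 e2 => reval s e1 <= reval s e2
  end.

Fixpoint icost (e : iexp) : nat :=
  match e with
  | ICst _ => 1
  | IGet _ e1 => (icost e1).+1
  | IAdd e1 e2 | ISub e1 e2 | IMul e1 e2 => (icost e1 + icost e2).+1
  end%N.

Fixpoint rcost (e : rexp) : nat :=
  match e with
  | RCst _ => 1
  | RGet _ e1 | ROfI e1 => (icost e1).+1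
  | RAdd e1 e2 | RSub e1 e2 | RMul e1 e2 | RDiv e1 e2 =>
      (rcost e1 + rcost e2).+1
  end%N.

Definition tcost (b : test) : nat :=
  match b with
  | TILe e1 e2 => (icost e1 + icost e2).+1
  | TRLe e1 e2 => (rcost e1 + rcost e2).+1
  end%N.

Definition upd (V : Type) (m : nat -> nat -> V) (a i : nat) (v : V) :
    nat -> nat -> V :=
  fun a' i' => if (a' == a) && (i' == i) then v else m a' i'.

(* exec p s s' t: started in s, p halts in s' after t time units. *)
Inductive exec (R : realType) : program -> state R -> state R -> nat -> Prop :=
| ExecSkip s : exec Skip s s 1%N
| ExecISet a e1 e2 s :
    exec (ISet a e1 e2) s
      (State (upd (iarr s) a (ieval s e1) (ieval s e2)) (rarr s))
      (icost e1 + icost e2).+1%N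
| ExecRSet a e1 e2 s :
    exec (RSet a e1 e2) s
      (State (iarr s) (upd (rarr s) a (ieval s e1) (reval s e2)))
      (icost e1 + rcost e2).+1%N
| ExecSeq p1 p2 s s1 s2 t1 t2 :
    exec p1 s s1 t1 -> exec p2 s1 s2 t2 -> exec (Seq p1 p2) s s2 (t1 + t2)%N
| ExecIfT b p1 p2 s s1 t :
    teval s b -> exec p1 s s1 t -> exec (If b p1 p2) s s1 (tcost b + t)%N
| ExecIfF b p1 p2 s s1 t :
    ~~ teval s b -> exec p2 s s1 t -> exec (If b p1 p2) s s1 (tcost b + t)%N
| ExecWhileT b p s s1 s2 t1 t2 :
    teval s b -> exec p s s1 t1 -> exec (While b p) s1 s2 t2 ->
    exec (While b p) s s2 (tcost b + t1 + t2)%N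
| ExecWhileF b p s : ~~ teval s b -> exec (While b p) s s (tcost b).

(* Natural arrays 0 and 1 hold (n, m) and the widths; real arrays 0, 1 and 2
   hold (epsilon, delta, L), the frequencies and the access costs.  All other
   entries are 0. *)
Definition initial (R : realType) (x : instance R) : state R :=
  State
    (fun a i => match a with
      | 0 => nth 0 [:: nchars x; size (bscheme x)] i
      | 1 => width (bscheme x) i
      | _ => 0
      end%N)
    (fun a i => match a with
      | 0%N => nth 0 [:: eps x; delta x; codelen x] i
      | 1%N => if insub i is Some c then (freq x c)%:R else 0
      | 2%N => acost (bscheme x) i
      | _ => 0
      end).

(* Preorder listing: 0 for an internal node, c + 1 for the leaf of c. *)
Fixpoint tree_code (n : nat) (T : tree n) : seq nat :=
  match T with
  | Leaf c => [:: (nat_of_ord c).+1]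
  | Node l r => 0%N :: tree_code l ++ tree_code r
  end.

(* The result is read off natural array 2. *)
Definition outputs (R : realType) (n : nat) (s : state R) (T : tree n) : Prop :=
  forall i, (i < size (tree_code T))%N -> iarr s 2 i = nth 0%N (tree_code T) i.

(* Main.v *)
(** Work with depth functions satisfying the Kraft equality instead of trees,
    and let [C d] be the access cost of depth [d].

    Depth reduction.  Call level [d] good if [C (d + 1) <= 2 * C d].  A bad level
    opens a block dearer than the one before, so there are at most [k] of them,
    and some [D = O(k (log n + 1 / delta))] is preceded by about
    [2 / delta + log n] consecutive good levels.  If a tree is deeper than [D],
    follow the path to a deepest leaf: the subtrees hanging off it at
    [2 / delta] of these levels have disjoint leaf sets, so pushing one of them
    down by one level raises neither the length nor the decode time by more than
    the factor [1 + delta], and the space this frees hosts all leaves deeper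
    than [D].

    Dynamic program.  The trees of depth at most [D] are searched level by level;
    a state records the levels left, the characters left (always the least
    frequent ones), the nodes of the current level and the code length left.  The
    length is counted in units of [eps / D] times the permitted length and
    rounded up once per level, so [D / eps + D] units suffice and the rounding
    costs a factor [1 + eps].  There are [O(n^2 D^2 / eps)] states, each handled
    in constant time. *)

Require Import Defs.
From mathcomp Require Import all_boot all_order all_algebra.
From mathcomp Require Import reals exp.
From mathcomp Require Import zify ring lra.
Import Order.TTheory GRing.Theory Num.Theory.
Local Open Scope ring_scope.

Set Implicit Arguments.
Unset Strict Implicit.
Unset Printing Implicit Defensive.

(** * Running programs *)

(** An uncapped tree can be [n - 1] levels deep, far too many for the table. The cap has to respect
    two objectives at once. Pushing down a side subtree adds one unit of length per unit of
    frequency and, from good levels, at most the cost that its leaves already have. Because [J] such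
    subtrees are disjoint, an average one pays at most [1 / J] of either total; asking for one
    subtree that is cheap in both respects doubles this, whence [J * delta >= 2].

    Optimality of the table rests on writing length and decode time as sums over levels of the
    frequency lying deeper than the level. Once the number of deeper characters is fixed for every
    level, taking the least frequent ones for the deeper places minimises all summands
    simultaneously. For the same reason the only quantities to be rounded are the prefix sums of the
    sorted frequencies, one per number of characters, and they can be rounded in advance.

    Trees occur only in the analysis. The program computes a sequence of depths and writes the
    preorder listing from it with a stack of depths. *)

Section Machine.
Variable R : realType.
Implicit Types (p : program) (s : state R) (Q : state R -> Prop).

Lemma exec_det p s s1 s2 t1 t2 :
  exec p s s1 t1 -> exec p s s2 t2 -> s1 = s2 /\ t1 = t2.
Proof.
move=> E1; elim: E1 s2 t2 => {p s s1 t1}.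
- by move=> s s2 t2 E; inversion E.
- by move=> a e1 e2 s s2 t2 E; inversion E.
- by move=> a e1 e2 s s2 t2 E; inversion E.
- move=> p1 p2 s s1 s2 t1 t2 _ IH1 _ IH2 s3 t3 E.
  inversion E as [| | |? ? ? s4 ? t4 t5 E4 E5| | | |]; subst.
  by have [? ?] := IH1 _ _ E4; subst; have [? ->] := IH2 _ _ E5.
- move=> b p1 p2 s s1 t Hb _ IH s2 t2 E.
  inversion E as [| | | |? ? ? ? ? t4 Hb' E4|? ? ? ? ? t4 Hb' E4| |]; subst.
    by have [-> ->] := IH _ _ E4.
  by rewrite Hb in Hb'.
- move=> b p1 p2 s s1 t Hb _ IH s2 t2 E.
  inversion E as [| | | |? ? ? ? ? t4 Hb' E4|? ? ? ? ? t4 Hb' E4| |]; subst.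
    by rewrite Hb' in Hb.
  by have [-> ->] := IH _ _ E4.
- move=> b p s s1 s2 t1 t2 Hb _ IH1 _ IH2 s3 t3 E.
  inversion E as [| | | | | |? ? ? s4 ? t4 t5 Hb' E4 E5|? ? ? Hb']; subst.
    by have [? ?] := IH1 _ _ E4; subst; have [? ->] := IH2 _ _ E5.
  by rewrite Hb in Hb'.
- move=> b p s Hb s2 t2 E.
  inversion E as [| | | | | |? ? ? s4 ? t4 t5 Hb' E4 E5|? ? ? Hb']; subst => //.
  by rewrite Hb' in Hb.
Qed.

Fixpoint iwrites p : seq nat :=
  match p with
  | Skip | RSet _ _ _ => [::]
  | ISet a _ _ => [:: a]
  | Seq p1 p2 | If _ p1 p2 => iwrites p1 ++ iwrites p2
  | While _ p1 => iwrites p1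
  end.

Fixpoint rwrites p : seq nat :=
  match p with
  | Skip | ISet _ _ _ => [::]
  | RSet a _ _ => [:: a]
  | Seq p1 p2 | If _ p1 p2 => rwrites p1 ++ rwrites p2
  | While _ p1 => rwrites p1
  end.

(** Whole arrays are framed, and the written ones are read off the syntax. Later phases recover
    inputs and earlier results in this way, without carrying them through invariants. *)
Definition frame p s s' :=
  (forall a, a \notin iwrites p -> iarr s' a =1 iarr s a) /\
  (forall a, a \notin rwrites p -> rarr s' a =1 rarr s a).

Lemma frame_refl p s : frame p s s. Proof. by []. Qed.

Lemma frame_trans p s1 s2 s3 : frame p s1 s2 -> frame p s2 s3 -> frame p s1 s3.
Proof.
move=> [I1 R1] [I2 R2]; split=> a Ha i; first by rewrite I2 // I1.
by rewrite R2 // R1.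
Qed.

Lemma frame_sub p q s s' :
  {subset iwrites p <= iwrites q} -> {subset rwrites p <= rwrites q} ->
  frame p s s' -> frame q s s'.
Proof.
move=> Hi Hr [FI FR]; split=> a Ha; [apply: FI|apply: FR]; apply: contra Ha.
  exact: Hi.
exact: Hr.
Qed.

Lemma exec_frame p s s' t : exec p s s' t -> frame p s s'.
Proof.
elim=> {p s s' t}.
- by [].
- move=> a e1 e2 s; split=> //= a' Ha i; rewrite /upd.
  by rewrite mem_seq1 in Ha; rewrite (negbTE Ha).
- move=> a e1 e2 s; split=> //= a' Ha i; rewrite /upd.
  by rewrite mem_seq1 in Ha; rewrite (negbTE Ha).
- move=> p1 p2 s s1 s2 t1 t2 _ F1 _ F2; apply: (@frame_trans _ _ s1).
    by apply: frame_sub F1 => a /= Ha; rewrite mem_cat Ha.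
  by apply: frame_sub F2 => a /= Ha; rewrite mem_cat Ha orbT.
- move=> b p1 p2 s s1 t _ _ F.
  by apply: frame_sub F => a /= Ha; rewrite mem_cat Ha.
- move=> b p1 p2 s s1 t _ _ F.
  by apply: frame_sub F => a /= Ha; rewrite mem_cat Ha orbT.
- by move=> b p s s1 s2 t1 t2 _ _ F1 _ F2; apply: frame_trans F1 F2.
- by [].
Qed.

(** Total correctness with a time bound; by [exec_det] it speaks about every execution. *)
Definition ends p s Q (T : nat) :=
  exists s' t, [/\ exec p s s' t, Q s' & (t <= T)%N].

Lemma ends_imp p s Q1 Q2 T1 T2 :
  (forall s', frame p s s' -> Q1 s' -> Q2 s') -> (T1 <= T2)%N ->
  ends p s Q1 T1 -> ends p s Q2 T2.
Proof.
move=> HQ HT [s' [t [E q Ht]]]; exists s', t; split=> //.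
  exact: HQ (exec_frame E) q.
exact: leq_trans HT.
Qed.

Lemma ends_le p s Q T1 T2 : (T1 <= T2)%N -> ends p s Q T1 -> ends p s Q T2.
Proof. exact: ends_imp. Qed.

Lemma ends_seq p1 p2 s Q1 Q T1 T2 :
  ends p1 s Q1 T1 ->
  (forall s1, frame p1 s s1 -> Q1 s1 -> ends p2 s1 Q T2) ->
  ends (Seq p1 p2) s Q (T1 + T2).
Proof.
move=> [s1 [t1 [E1 q1 H1]]] /(_ s1 (exec_frame E1) q1) [s2 [t2 [E2 q2 H2]]].
by exists s2, (t1 + t2)%N; split; [apply: ExecSeq E1 E2|by []|apply: leq_add].
Qed.

Lemma ends_if b p1 p2 s Q T :
  (teval s b -> ends p1 s Q T) -> (~~ teval s b -> ends p2 s Q T) ->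
  ends (If b p1 p2) s Q (tcost b + T).
Proof.
move=> H1 H2; case: (boolP (teval s b)) => Hb.
  have [s' [t [E q Ht]]] := H1 Hb; exists s', (tcost b + t)%N; split=> //.
    exact: ExecIfT.
  by rewrite leq_add2l.
have [s' [t [E q Ht]]] := H2 Hb; exists s', (tcost b + t)%N; split=> //.
  exact: ExecIfF.
by rewrite leq_add2l.
Qed.

Fixpoint straight p : bool :=
  match p with
  | While _ _ => false
  | Seq p1 p2 | If _ p1 p2 => straight p1 && straight p2
  | _ => true
  end.

Definition iset s a i v : state R := State (upd (iarr s) a i v) (rarr s).
Definition rset s a i v : state R := State (iarr s) (upd (rarr s) a i v).

(** Symbolic evaluation of loop-free code. The [While] cases here and in [mcost] are placeholders,
    as both are applied to [straight] programs. *)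
Fixpoint run p s : state R :=
  match p with
  | Skip | While _ _ => s
  | ISet a e1 e2 => iset s a (ieval s e1) (ieval s e2)
  | RSet a e1 e2 => rset s a (ieval s e1) (reval s e2)
  | Seq p1 p2 => run p2 (run p1 s)
  | If b p1 p2 => if teval s b then run p1 s else run p2 s
  end.

Fixpoint mcost p : nat :=
  match p with
  | Skip | While _ _ => 1
  | ISet a e1 e2 => (icost e1 + icost e2).+1
  | RSet a e1 e2 => (icost e1 + rcost e2).+1
  | Seq p1 p2 => mcost p1 + mcost p2
  | If b p1 p2 => tcost b + maxn (mcost p1) (mcost p2)
  end%N.

Lemma exec_straight p s :
  straight p -> exists2 t, exec p s (run p s) t & (t <= mcost p)%N.
Proof.
elim: p s => //=.
- by move=> s _; exists 1%N => //; constructor.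
- by move=> a e1 e2 s _; eexists; [apply: ExecISet|].
- by move=> a e1 e2 s _; eexists; [apply: ExecRSet|].
- move=> p1 IH1 p2 IH2 s /andP[/(IH1 s)[t1 E1 H1] /(IH2 (run p1 s))[t2 E2 H2]].
  by exists (t1 + t2)%N; [apply: ExecSeq E1 E2|apply: leq_add].
- move=> b p1 IH1 p2 IH2 s /andP[/(IH1 s)[t1 E1 H1] /(IH2 s)[t2 E2 H2]].
  case: ifPn => Hb.
    exists (tcost b + t1)%N; first exact: ExecIfT Hb E1.
    by rewrite leq_add2l leq_max H1.
  exists (tcost b + t2)%N; first exact: ExecIfF Hb E2.
  by rewrite leq_add2l leq_max H2 orbT.
Qed.

Lemma ends_straight p s Q : straight p -> Q (run p s) -> ends p s Q (mcost p).
Proof. by case/(exec_straight s)=> t E H q; exists (run p s), t. Qed.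

(** The invariant is indexed by the number of rounds done, and the exact number [N] of rounds is
    fixed in advance; it serves both as variant and as time count. *)
Lemma ends_while s0 b p N T (I : nat -> state R -> Prop) :
  I 0%N s0 ->
  (forall i s, (i < N)%N -> frame p s0 s -> I i s ->
     teval s b /\ ends p s (I i.+1) T) ->
  (forall s, frame p s0 s -> I N s -> ~~ teval s b) ->
  ends (While b p) s0 (I N) (N * (tcost b + T) + tcost b).
Proof.
move=> H0 Hstep Hend.
suff: forall m i s, (i + m = N)%N -> frame p s0 s -> I i s ->
    ends (While b p) s (I N) (m * (tcost b + T) + tcost b).
  by apply; [apply: add0n|apply: frame_refl|].
elim=> [|m IH] i s Him F Is.
  rewrite addn0 in Him; subst i.
  exists s, (tcost b); split=> //; exact: ExecWhileF (Hend _ F Is).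
have [Hb [s1 [t1 [E1 I1 H1]]]] : teval s b /\ ends p s (I i.+1) T.
  by apply: Hstep => //; rewrite -Him addnS ltnS leq_addr.
have [s2 [t2 [E2 I2 H2]]] := IH i.+1 s1 (etrans (addSnnS i m) Him)
  (frame_trans F (exec_frame E1)) I1.
exists s2, (tcost b + t1 + t2)%N; split=> //; first exact: ExecWhileT Hb E1 E2.
by rewrite mulSn; move: H2; set X := (m * _)%N; lia.
Qed.

Definition IV a := IGet a (ICst 0).

Definition incr a := ISet a (ICst 0) (IAdd (IV a) (ICst 1)).

Definition For a e p :=
  Seq (ISet a (ICst 0) (ICst 0))
      (While (TILe (IAdd (IV a) (ICst 1)) e) (Seq p (incr a))).

(** The counter is set outside [p], so the invariant must survive writes to it; its current value
    reaches the body separately, as [iarr s a 0 = i]. *)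
Lemma ends_for s0 a e p N T (I : nat -> state R -> Prop) :
  a \notin iwrites p ->
  (forall s, frame (For a e p) s0 s -> ieval s e = N) ->
  (forall i s v, I i s -> I i (iset s a 0 v)) ->
  I 0%N s0 ->
  (forall i s, (i < N)%N -> frame (For a e p) s0 s -> iarr s a 0 = i -> I i s ->
     ends p s (I i.+1) T) ->
  ends (For a e p) s0 (I N) (N.+1 * (T + icost e + 20)).
Proof.
move=> Ha He Hst H0 Hstep.
pose s1 := iset s0 a 0 0.
pose J i s := iarr s a 0 = i /\ I i s.
have F1 s : frame (Seq p (incr a)) s1 s -> frame (For a e p) s0 s.
  move=> F; apply: (@frame_trans _ _ s1).
    apply: (@frame_sub (ISet a (ICst 0) (ICst 0))) => //.
      by move=> b /=; rewrite mem_seq1 => /eqP ->; rewrite mem_head.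
    by split=> //= b Hb i; rewrite /upd; rewrite mem_seq1 in Hb; rewrite (negbTE Hb).
  by apply: frame_sub F => // b Hb; rewrite in_cons Hb orbT.
have Hw := @ends_while s1 (TILe (IAdd (IV a) (ICst 1)) e) (Seq p (incr a)) N
  (T + mcost (incr a)) J.
apply: (@ends_imp _ _ (J N)) (leqnn _) _; first by move=> ? _ [].
apply: (@ends_imp _ _ (J N) _ (mcost (ISet a (ICst 0) (ICst 0)) + (N *
    (tcost (TILe (IAdd (IV a) (ICst 1)) e) + (T + mcost (incr a))) +
    tcost (TILe (IAdd (IV a) (ICst 1)) e)))%N) => //.
  by rewrite /= mulSn; nia.
apply: (@ends_seq _ _ _ (fun s => s = s1)).
  exact: ends_straight.
move=> _ _ ->; apply: Hw.
- by split; [rewrite /= /upd !eqxx|apply: Hst].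
- move=> i s Hi F [Hai Is]; have F' := F1 _ F; split.
    by rewrite /= Hai (He _ F') addn1.
  apply: (@ends_seq _ _ _ (fun s' => I i.+1 s' /\ iarr s' a 0 = i)).
    have := Hstep i s Hi F' Hai Is; apply: ends_imp => // s' Fp Is'; split=> //.
    by rewrite Fp.1.
  move=> s2 _ [I2 A2]; apply: ends_straight => //=; split.
    by rewrite /= /upd !eqxx /= A2 addn1.
  exact: Hst.
- by move=> s F [Hai _]; rewrite /= Hai (He _ (F1 _ F)) addn1 ltnn.
Qed.

End Machine.
Arguments frame_refl {R p s}.

(** * Depth reduction *)

Section Kraft.
Variables (R : realType) (n : nat).
Implicit Types (T l r : tree n) (c : 'I_n).

Definition half_pow (d : nat) : R := 2^-1 ^+ d.

Lemma half_pow_gt0 d : 0 < half_pow d. Proof. by rewrite exprn_gt0 // invr_gt0. Qed.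

Lemma half_powS d : half_pow d.+1 = 2^-1 * half_pow d. Proof. exact: exprS. Qed.

Lemma half_powD d e : half_pow (d + e) = half_pow d * half_pow e.
Proof. exact: exprD. Qed.

Lemma half_pow_exp2 d : half_pow d * (2 ^ d)%:R = 1.
Proof. by rewrite natrX /half_pow -exprMn mulVf ?expr1n // pnatr_eq0. Qed.

Lemma exp2_half_pow D d : (d <= D)%N -> (2 ^ (D - d))%:R = (2 ^ D)%:R * half_pow d.
Proof.
move=> H; have E : (2 ^ D = 2 ^ (D - d) * 2 ^ d)%N by rewrite -expnD subnK.
by rewrite E natrM -mulrA [X in _ * X]mulrC half_pow_exp2 mulr1.
Qed.

Lemma half_pow_le d e : (d <= e)%N -> half_pow e <= half_pow d.
Proof.
move=> H; rewrite -(subnKC H) half_powD ler_piMr //; first exact/ltW/half_pow_gt0.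
by apply: exprn_ile1; rewrite ?invr_ge0 // invf_le1 // ler1n.
Qed.

Fixpoint height T : nat :=
  if T is Node l r then (maxn (height l) (height r)).+1 else 0%N.

Lemma depth_le_height T c : (depth T c <= height T)%N.
Proof. by elim: T => //= l IHl r IHr; case: ifP => _; lia. Qed.

Lemma depth_nodel l r c :
  c \in leaves l -> depth (Node l r) c = (depth l c).+1.
Proof. by move=> /= ->. Qed.

Lemma uniq_node l r : uniq (leaves (Node l r)) ->
  [/\ uniq (leaves l), uniq (leaves r)
    & forall c, c \in leaves r -> c \in leaves l = false].
Proof.
rewrite /= cat_uniq => /and3P[ul /hasPn H ur]; split=> // c /H.
by move/negbTE.
Qed.

Lemma depth_noder l r c : uniq (leaves (Node l r)) ->
  c \in leaves r -> depth (Node l r) c = (depth r c).+1.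
Proof. by case/uniq_node=> _ _ H /H /= ->. Qed.

Definition mass T (P : pred 'I_n) : R :=
  \sum_(c <- leaves T | P c) half_pow (depth T c).

Lemma mass_node l r P : uniq (leaves (Node l r)) ->
  mass (Node l r) P = 2^-1 * (mass l P + mass r P).
Proof.
move=> u; rewrite /mass [leaves _]/= big_cat /= mulrDr !mulr_sumr.
congr (_ + _); rewrite big_seq_cond [RHS]big_seq_cond; apply: eq_bigr.
  by move=> c /andP[Hc _]; rewrite -half_powS -(depth_nodel r Hc).
by move=> c /andP[Hc _]; rewrite -half_powS -(depth_noder u Hc).
Qed.

Lemma eq_mass T P Q : {in leaves T, P =1 Q} -> mass T P = mass T Q.
Proof.
move=> H; rewrite /mass big_seq_cond [RHS]big_seq_cond; apply: eq_bigl => c.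
by case: (boolP (c \in _)) => //= /H.
Qed.

Lemma mass_pred0 T : mass T xpred0 = 0. Proof. exact: big_pred0. Qed.

Lemma mass_predT T : uniq (leaves T) -> mass T predT = 1.
Proof.
elim: T => [c _|l IHl r IHr u]; first by rewrite /mass big_seq1.
have [ul ur _] := uniq_node u; rewrite mass_node // IHl // IHr //.
lra.
Qed.

(* The depth at which the path to [c] leaves the path to a deepest leaf. *)
Fixpoint branch T c : nat :=
  if T is Node l r then
    let T' := if (height r <= height l)%N then l else r in
    if c \in leaves T' then
      (if (height r <= height l)%N then branch l c else branch r c).+1
    else 0%N
  else 0%N.

Lemma branch_lt_depth T c : uniq (leaves T) ->
  (branch T c < height T)%N -> (branch T c < depth T c)%N.
Proof.
elim: T => //= l IHl r IHr u; have [ul ur H] := uniq_node u.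
case: (leqP (height r) (height l)) => Hh /=.
  by case: (c \in leaves l) => // Hb; apply: IHl.
case: ifPn => // Hc Hb; move: (H _ Hc) => ->; exact: IHr.
Qed.

(** The characters with branching depth [t] are the leaves of one subtree, rooted at depth [t + 1]
    beside the path. The deepest leaf itself has branching depth [height T] and is excluded. *)
Lemma mass_branch T t : uniq (leaves T) -> (t < height T)%N ->
  mass T (fun c => branch T c == t) = half_pow t.+1.
Proof.
elim: T t => //= l IHl r IHr t u; have [ul ur H] := uniq_node u.
rewrite mass_node // ltnS /=; case: (leqP (height r) (height l)) => Hh.
  have -> : mass r (fun c => (if c \in leaves l then (branch l c).+1 else 0) == t)
      = mass r (fun _ => 0%N == t) by apply: eq_mass => c /H ->.
  have -> : mass l (fun c => (if c \in leaves l then (branch l c).+1 else 0) == t)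
      = mass l (fun c => (branch l c).+1 == t) by apply: eq_mass => c ->.
  case: t => [|t] Ht; rewrite half_powS.
    by rewrite mass_pred0 mass_predT // /half_pow expr0; lra.
  by rewrite mass_pred0 addr0 -IHl //; lia.
have -> : mass r (fun c => (if c \in leaves r then (branch r c).+1 else 0) == t)
    = mass r (fun c => (branch r c).+1 == t) by apply: eq_mass => c ->.
have -> : mass l (fun c => (if c \in leaves r then (branch r c).+1 else 0) == t)
    = mass l (fun _ => 0%N == t).
  by apply: eq_mass => c Hc; case: ifP => // /H; rewrite Hc.
case: t => [|t] Ht; rewrite half_powS.
  by rewrite mass_pred0 mass_predT // /half_pow expr0; lra.
by rewrite mass_pred0 add0r -IHr //; lia.
Qed.

Lemma sum_leaves T (P : pred 'I_n) (F : 'I_n -> R) : prefix_tree T ->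
  \sum_(c <- leaves T | P c) F c = \sum_(c | P c) F c.
Proof. by move=> pT; rewrite (perm_big _ pT) /= big_enum_cond. Qed.

Lemma prefix_uniq T : prefix_tree T -> uniq (leaves T).
Proof. by move/perm_uniq ->; apply: enum_uniq. Qed.

(* All summands are divisible by the one of a deepest character, so a strict
   Kraft inequality leaves room to shorten its codeword. *)
Lemma kraft_shorten D (d : 'I_n -> nat) : (0 < n)%N ->
  (forall c, d c <= D)%N -> (\sum_c 2 ^ (D - d c) <= 2 ^ D)%N ->
  exists2 d' : 'I_n -> nat, forall c, (d' c <= d c)%N
    & (\sum_c 2 ^ (D - d' c) = 2 ^ D)%N.
Proof.
move=> n0; have [m] := ubnP (\sum_c d c)%N; elim: m => // m IH in d *.
rewrite ltnS => Hm HD HK.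
have [E|NE] := eqVneq (\sum_c 2 ^ (D - d c))%N (2 ^ D)%N; first by exists d.
have [c Hc] : exists c, forall c', (d c' <= d c)%N.
  exists [arg max_(i > Ordinal n0) d i]%N.
  by case: arg_maxnP => // i _ Hi c'; apply: Hi.
have dv : (2 ^ (D - d c) %| \sum_c 2 ^ (D - d c))%N.
  by apply: dvdn_sum => i _; apply: dvdn_exp2l; have := Hc i; lia.
have dv2 : (2 ^ (D - d c) %| 2 ^ D)%N by apply: dvdn_exp2l; lia.
have lt : (\sum_c 2 ^ (D - d c) < 2 ^ D)%N by rewrite ltn_neqAle NE.
have room : (\sum_c 2 ^ (D - d c) + 2 ^ (D - d c) <= 2 ^ D)%N.
  have := dvdn_leq _ (dvdn_sub dv2 dv); rewrite subn_gt0 => /(_ lt); lia.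
have dpos : (0 < d c)%N.
  rewrite lt0n; apply/eqP => E; move: room; rewrite E subn0.
  by rewrite (bigD1 c) //= E subn0; have := expn_gt0 2 D; lia.
pose e i := if i == c then (d c).-1 else d i.
have le_e i : (e i <= d i)%N by rewrite /e; case: eqP => [->|//]; lia.
have He : (\sum_c 2 ^ (D - e c) = \sum_c 2 ^ (D - d c) + 2 ^ (D - d c))%N.
  rewrite (bigD1 c) //= [in RHS](bigD1 c) //= addnAC; congr (_ + _)%N.
    rewrite /e eqxx; have -> : (D - (d c).-1 = (D - d c).+1)%N.
      by have := HD c; lia.
    by rewrite expnS mul2n addnn.
  by apply: eq_bigr => i /negbTE; rewrite /e => ->.
have [||| d' le' E'] := IH e.
- apply: leq_trans Hm; rewrite (bigD1 c) //= [X in (_ < X)%N](bigD1 c) //=.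
  rewrite {1}/e eqxx -addSn prednK // leq_add2l; apply: leq_sum => i _.
  exact: le_e.
- by move=> i; apply: leq_trans (le_e i) (HD i).
- by rewrite He.
by exists d' => // i; apply: leq_trans (le' i) (le_e i).
Qed.

(** After normalising both totals, the numbers [x i / X + y i / Y] sum to at most 2, whereas an
    index violating either bound contributes more than [2 / J]. A vanishing total is harmless: all
    its terms are 0 and cannot violate anything. *)
Lemma pigeonhole2 J (x y : 'I_J -> R) (X Y : R) : (0 < J)%N ->
  (forall i, 0 <= x i) -> (forall i, 0 <= y i) ->
  \sum_i x i <= X -> \sum_i y i <= Y ->
  exists i, J%:R * x i <= 2 * X /\ J%:R * y i <= 2 * Y.
Proof.
move=> J0 x0 y0 HX HY.
have X0 : 0 <= X by apply: le_trans HX; apply: sumr_ge0.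
have Y0 : 0 <= Y by apply: le_trans HY; apply: sumr_ge0.
have norm1 (z : 'I_J -> R) Z i : (forall i, 0 <= z i) -> \sum_i z i <= Z ->
    ~~ (J%:R * z i <= 2 * Z) -> 2 < J%:R * (z i / Z).
  move=> z0 HZ; rewrite -ltNge => H.
  have le_zZ : z i <= Z.
    by apply: le_trans HZ; rewrite (bigD1 i) //= lerDl sumr_ge0.
  have Zp : 0 < Z.
    rewrite lt_def (le_trans (z0 i) le_zZ) andbT; apply/eqP => E; subst.
    have zi : z i = 0 by apply/eqP; rewrite eq_le le_zZ z0.
    by rewrite zi !mulr0 ltxx in H.
  by rewrite mulrA ltr_pdivlMr.
have sum1 (z : 'I_J -> R) Z : 0 <= Z -> \sum_i z i <= Z ->
    \sum_i z i / Z <= 1.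
  move=> Z0 HZ; rewrite -mulr_suml.
  have [->|Zn] := eqVneq Z 0; first by rewrite invr0 mulr0.
  by rewrite ler_pdivrMr ?mul1r // lt_def Zn.
have [/existsP[i /andP[? ?]]|] :=
  boolP [exists i, (J%:R * x i <= 2 * X) && (J%:R * y i <= 2 * Y)].
  by exists i.
rewrite negb_exists => /forallP H.
have gt2 i : 2 < J%:R * (x i / X + y i / Y).
  have xX : 0 <= J%:R * (x i / X) by rewrite mulr_ge0 // divr_ge0.
  have yY : 0 <= J%:R * (y i / Y) by rewrite mulr_ge0 // divr_ge0.
  rewrite mulrDr; have := H i; rewrite negb_and => /orP[] K.
    by have := norm1 _ _ _ x0 HX K; lra.
  by have := norm1 _ _ _ y0 HY K; lra.
have : \sum_(i < J) (2 : R) < \sum_i J%:R * (x i / X + y i / Y).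
  by apply: ltr_sum => //; apply/hasP; exists (Ordinal J0); rewrite ?mem_index_enum.
rewrite sumr_const card_ord -mulr_sumr big_split /= -[2 *+ J]mulr_natl ltr_pM2l ?ltr0n //.
by have := sum1 _ _ X0 HX; have := sum1 _ _ Y0 HY; lra.
Qed.

Lemma tree_gt0 T : (0 < n)%N.
Proof. by elim: T => // c; apply: leq_ltn_trans (ltn_ord c). Qed.

Section DepthCap.
Variables (f : 'I_n -> nat) (C : nat -> R) (T : tree n) (lam J D : nat).
Variable delta : R.
Hypothesis pT : prefix_tree T.
Hypothesis n_le : (n <= 2 ^ lam)%N.
Hypothesis J_gt0 : (0 < J)%N.
Hypothesis D_ge : (J + lam + 2 <= D)%N.
Hypothesis C0 : 0 <= C 0.
Hypothesis C_mono : {homo C : d e / (d <= e)%N >-> d <= e}.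
Hypothesis C_dbl : forall d, (D - (J + lam + 2) <= d < D)%N -> C d.+1 <= 2 * C d.
Hypothesis J_delta : 2 <= J%:R * delta.

Let a := (D - (J + lam + 2))%N.

(** Leaves of depth at least [D] are raised to [D.-1], so they get no more expensive; the others
    have depth at most [D.-1] and can afford one extra level below the cap [D]. *)
Definition cap t c : nat :=
  if (D.-1 < depth T c)%N then D.-1
  else (depth T c + (branch T c == t))%N.

Lemma cap_le t c : (cap t c <= D)%N.
Proof. by rewrite /cap; case: ltnP; case: (branch T c == t); lia. Qed.

Lemma C_ge0 d : 0 <= C d.
Proof. by apply: le_trans C0 _; apply: C_mono. Qed.

Hypothesis deep : (D < height T)%N.

(** Pushing down the subtree of mass [half_pow t.+1] frees [half_pow t.+2]. Up to [n <= 2 ^ lam]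
    raised leaves take at most [half_pow (D.-1 - lam)], which fits because [t + 2 <= D.-1 - lam].
    This is the origin of the summand [lam + 2] in the run length. *)
Lemma kraft_cap t : (t < a + J)%N -> \sum_c half_pow (cap t c) <= 1.
Proof.
move=> Ht; have uT := prefix_uniq pT.
have H c : half_pow (cap t c) <= half_pow D.-1 + half_pow (depth T c)
    - 2^-1 * (if branch T c == t then half_pow (depth T c) else 0).
  have := half_pow_gt0 (depth T c); have := half_pow_gt0 D.-1.
  rewrite /cap; case: ltnP => _; case: eqP => _; rewrite ?addn1 ?addn0 ?half_powS; lra.
apply: le_trans (ler_sum _ (fun c _ => H c)) _.
rewrite big_split big_split /= sumr_const card_ord sumrN -mulr_sumr -big_mkcond /=.
have := mass_branch uT (leq_trans Ht _ : (t < height T)%N).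
rewrite /mass sum_leaves // => -> ; last by lia.
have := mass_predT uT; rewrite /mass sum_leaves // => ->.
rewrite -half_powS -mulr_natl.
suff : n%:R * half_pow D.-1 <= half_pow t.+2 by lra.
apply: (@le_trans _ _ ((2 ^ lam)%:R * half_pow D.-1)).
  by rewrite ler_pM2r ?half_pow_gt0 // ler_nat.
have -> : D.-1 = (lam + (D.-1 - lam))%N by lia.
rewrite half_powD mulrA [_ * half_pow lam]mulrC half_pow_exp2 mul1r.
by apply: half_pow_le; lia.
Qed.

Lemma cap_len t c :
  (cap t c)%:R <= (depth T c)%:R + (if branch T c == t then 1 else 0) :> R.
Proof.
apply: (@le_trans _ _ (depth T c + (branch T c == t))%:R).
  by rewrite ler_nat /cap; case: ltnP; lia.
by rewrite natrD; case: eqP.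
Qed.

(** A leaf that is pushed down is deeper than its branching depth [t >= a] and less deep than [D],
    hence on a good level, where one more level at most doubles its cost. *)
Lemma cap_cost t c : (a <= t < a + J)%N ->
  C (cap t c) <= C (depth T c) + (if branch T c == t then C (depth T c) else 0).
Proof.
move=> /andP[Ha Ht]; have Cd := C_ge0 (depth T c); rewrite /cap.
have uT := prefix_uniq pT.
case: ltnP => Hd.
  have := C_mono (ltnW Hd); case: eqP; lra.
case: eqP => E; rewrite ?addn0 ?addr0 // addn1 -mulr2n -mulr_natl; apply: C_dbl.
have : (branch T c < depth T c)%N by apply: branch_lt_depth => //; lia.
rewrite -/a; lia.
Qed.

Lemma deep_depth_cap : exists d : 'I_n -> nat,
  [/\ forall c, (d c <= D)%N, (\sum_c 2 ^ (D - d c) = 2 ^ D)%N,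
      \sum_c (f c)%:R * (d c)%:R
        <= (1 + delta) * \sum_c (f c)%:R * (depth T c)%:R
    & \sum_c (f c)%:R * C (d c)
        <= (1 + delta) * \sum_c (f c)%:R * C (depth T c)].
Proof.
have uT := prefix_uniq pT.
pose x (g : 'I_n -> R) (i : 'I_J) :=
  \sum_(c | branch T c == (a + i)%N) (f c)%:R * g c.
have x0 g i : (forall c, 0 <= g c) -> 0 <= x g i.
  by move=> g0; apply: sumr_ge0 => c _; rewrite mulr_ge0.
have sumx g (h : 'I_n -> R) : (forall c, 0 <= h c) ->
    (forall c (i : 'I_J), branch T c = (a + i)%N -> g c <= h c) ->
    \sum_i x g i <= \sum_c (f c)%:R * h c.
  move=> h0 gh; rewrite /x (exchange_big_dep xpredT) //=; apply: ler_sum => c _.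
  have [/existsP[i Hi]|] := boolP [exists i : 'I_J, branch T c == (a + i)%N].
    rewrite (bigD1 i) //= big1 ?addr0; last first.
      move=> j /andP[Hj ji]; case/eqP: ji; apply/val_inj => /=.
      by move/eqP: Hi Hj => -> /eqP; lia.
    by rewrite ler_wpM2l // (gh c i) //; apply/eqP.
  rewrite negb_exists => /forallP H; rewrite big_pred0 ?mulr_ge0 // => i.
  exact/negbTE/H.
(* For the length the penalty of a pushed leaf is 1, which its own depth dominates: a leaf below a
   branching point has positive depth. *)
have X1 : \sum_i x (fun=> 1) i <= \sum_c (f c)%:R * (depth T c)%:R.
  apply: sumx => [//|c i Hb]; rewrite ler1n; have := ltn_ord i => Hi.
  by apply: leq_ltn_trans (branch_lt_depth uT _) => //; lia.
have Y1 : \sum_i x (C \o depth T) i <= \sum_c (f c)%:R * C (depth T c).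
  by apply: sumx => // c; apply: C_ge0.
have [i [Hx Hy]] := pigeonhole2 J_gt0 (fun i => x0 _ i (fun=> ler01))
  (fun i => x0 _ i (fun=> C_ge0 _)) X1 Y1.
have aiJ : (a <= a + i < a + J)%N by rewrite leq_addr ltn_add2l ltn_ord.
have n0 : (0 < n)%N := tree_gt0 T.
(* The capped depths satisfy only the Kraft inequality. Shortening codewords restores equality and
   increases neither sum, since [C] is monotone. *)
have [||d' le_d' Ed'] := @kraft_shorten D (cap (a + i)) n0.
- exact: cap_le.
- rewrite -(ler_nat R) natr_sum.
  under eq_bigr => c _ do rewrite (exp2_half_pow (cap_le _ _)).
  rewrite -mulr_sumr ler_piMr ?ler0n //; apply: kraft_cap.
  by case/andP: aiJ.
have penalty (g h h' : 'I_n -> R) : (forall c, h' c <= h c +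
    (if branch T c == (a + i)%N then g c else 0)) ->
    \sum_c (f c)%:R * h' c <= \sum_c (f c)%:R * h c + x g i.
  move=> H; rewrite /x [X in _ <= _ + X]big_mkcond -big_split /=.
  apply: ler_sum => c _; apply: le_trans (ler_wpM2l (ler0n _ _) (H c)) _.
  by case: ifP => _; rewrite mulrDr ?mulr0.
have small (X y : R) : 0 <= X -> J%:R * y <= 2 * X -> y <= delta * X.
  move=> X0 H; rewrite -(@ler_pM2l _ J%:R) ?ltr0n //; apply: le_trans H _.
  by rewrite mulrA ler_wpM2r.
exists d'; split=> //.
- by move=> c; apply: leq_trans (le_d' c) (cap_le _ _).
- apply: (@le_trans _ _ (\sum_c (f c)%:R * (cap (a + i) c)%:R)).
    by apply: ler_sum => c _; rewrite ler_wpM2l // ler_nat.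
  apply: le_trans (penalty (fun=> 1) (fun c => (depth T c)%:R) _ (cap_len _)) _.
  rewrite mulrDl mul1r lerD2l; apply: small => //; apply: sumr_ge0 => c _.
  by rewrite mulr_ge0.
- apply: (@le_trans _ _ (\sum_c (f c)%:R * C (cap (a + i) c))).
    by apply: ler_sum => c _; rewrite ler_wpM2l // C_mono.
  have P := penalty (C \o depth T) (C \o depth T) _ (fun c => cap_cost c aiJ).
  apply: le_trans P _.
  rewrite mulrDl mul1r lerD2l; apply: small => //; apply: sumr_ge0 => c _.
  by rewrite mulr_ge0 // C_ge0.
Qed.
End DepthCap.

Theorem depth_cap (f : 'I_n -> nat) (C : nat -> R) T (lam J D : nat)
    (delta : R) :
  prefix_tree T -> (n <= 2 ^ lam)%N -> (0 < J)%N -> (J + lam + 2 <= D)%N ->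
  0 <= C 0 -> {homo C : d e / (d <= e)%N >-> d <= e} ->
  (forall d, (D - (J + lam + 2) <= d < D)%N -> C d.+1 <= 2 * C d) ->
  0 <= delta -> 2 <= J%:R * delta ->
  exists d : 'I_n -> nat,
  [/\ forall c, (d c <= D)%N, (\sum_c 2 ^ (D - d c) = 2 ^ D)%N,
      \sum_c (f c)%:R * (d c)%:R
        <= (1 + delta) * \sum_c (f c)%:R * (depth T c)%:R
    & \sum_c (f c)%:R * C (d c)
        <= (1 + delta) * \sum_c (f c)%:R * C (depth T c)].
Proof.
move=> pT nl J0 DH C0 Cm Cd d0 Jd.
have [deep|shallow] := ltnP D (height T).
  exact: (@deep_depth_cap f C T lam J D delta).
have dD c : (depth T c <= D)%N := leq_trans (depth_le_height T c) shallow.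
have C_pos d : 0 <= C d by apply: le_trans C0 (Cm _ _ _).
exists (depth T); split=> //.
- apply/eqP; rewrite -(eqr_nat R) natr_sum; apply/eqP.
  under eq_bigr => c _ do rewrite (exp2_half_pow (dD c)).
  rewrite -mulr_sumr; have := mass_predT (prefix_uniq pT).
  by rewrite /mass sum_leaves // => ->; rewrite mulr1.
- rewrite ler_peMl ?lerDl // sumr_ge0 // => c _; exact: mulr_ge0.
- rewrite ler_peMl ?lerDl // sumr_ge0 // => c _; exact: mulr_ge0.
Qed.

End Kraft.

(** * Costs of levels *)

Section Levels.
Variables (R : realType) (bs : scheme R).
Hypothesis bs_pos : forall j, (j < size bs)%N ->
  (0 < width bs j)%N /\ 0 <= acost bs j.

(* State after [d] levels: blocks opened, unused levels of the last one, and
   access cost so far. *)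
Definition lstep (x : nat * nat * R) : nat * nat * R :=
  if (1 <= x.1.2)%N then (x.1.1, (x.1.2 - 1)%N, x.2)
  else (x.1.1.+1, (width bs x.1.1 - 1)%N, x.2 + acost bs x.1.1).

Definition lst d := iter d lstep (0%N, 0%N, 0).
Definition lblk d := (lst d).1.1.
Definition lrem d := (lst d).1.2.
Definition lcost d := (lst d).2.

Lemma lblkS d : lblk d.+1 = if (1 <= lrem d)%N then lblk d else (lblk d).+1.
Proof. by rewrite /lblk /lrem /lst iterS /lstep; case: ifP. Qed.

Lemma lremS d :
  lrem d.+1 = if (1 <= lrem d)%N then (lrem d - 1)%N else (width bs (lblk d) - 1)%N.
Proof. by rewrite /lblk /lrem /lst iterS /lstep; case: ifP. Qed.

Lemma lcostS d :
  lcost d.+1 = if (1 <= lrem d)%N then lcost d else lcost d + acost bs (lblk d).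
Proof. by rewrite /lcost /lblk /lrem /lst iterS /lstep; case: ifP. Qed.

Lemma acost_ge0 j : 0 <= acost bs j.
Proof.
have [/bs_pos[]//|H] := ltnP j (size bs).
by rewrite /acost nth_default.
Qed.

Lemma lcost_mono : {homo lcost : d e / (d <= e)%N >-> d <= e}.
Proof.
move=> d e /subnKC <-; elim: (e - d)%N => [|i IH]; first by rewrite addn0.
rewrite addnS lcostS; case: ifP => // _; apply: le_trans IH _.
by rewrite lerDl acost_ge0.
Qed.

Lemma lcost_ge0 d : 0 <= lcost d.
Proof. exact: (@lcost_mono 0). Qed.

Let W h := (\sum_(j < h) width bs j)%N.

Let WS h : W h.+1 = (W h + width bs h)%N.
Proof. by rewrite /W big_ord_recr. Qed.

(** Together the three facts make [lblk d] the least number of blocks that cover depth [d], the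
    number for which [nblocks] searches. The bound on [d] ensures that a block is left whenever one
    has to be opened. *)
Lemma lblk_spec d : (d <= W (size bs))%N ->
  [/\ W (lblk d) = (d + lrem d)%N, (lblk d <= size bs)%N
    & forall h, (h < lblk d)%N -> (W h < d)%N].
Proof.
elim: d => [_|d IH Hd]; first by split; rewrite // /W big_ord0.
have [E Hs Hh] := IH (ltnW Hd); rewrite lblkS lremS; case: ifPn => Hr.
  by split=> //; [lia|move=> h /Hh; lia].
have lts : (lblk d < size bs)%N.
  by rewrite ltn_neqAle Hs andbT; apply/eqP => K; rewrite K in E; lia.
have [w0 _] := bs_pos lts; split=> //; first by rewrite WS E; lia.
move=> h; rewrite ltnS leq_eqVlt => /orP[/eqP->|/Hh]; lia.
Qed.

Lemma nblocksE d : (d <= W (size bs))%N -> nblocks bs d = lblk d.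
Proof.
move=> /lblk_spec[E Hs Hh]; rewrite /nblocks.
set P := (fun h => _ <= _)%N; set s := iota _ _.
have PE h : P h = (d <= W h)%N by [].
have hP : has P s.
  apply/hasP; exists (lblk d); last by rewrite PE E leq_addr.
  by rewrite mem_iota /= add0n ltnS.
have := nth_find 0%N hP; have := before_find (s := s) (a := P) 0%N.
have := hP; rewrite has_find size_iota => Hf.
rewrite nth_iota // add0n PE => Hb Hn.
case: (ltngtP (find P s) (lblk d)) => // [/Hh|/Hb]; first by lia.
rewrite nth_iota; last by lia.
by rewrite add0n PE E leq_addr.
Qed.

Lemma lcostE d : lcost d = \sum_(i < lblk d) acost bs i.
Proof.
elim: d => [|d IH]; first by rewrite big_ord0.
by rewrite lcostS lblkS; case: ifP => // _; rewrite big_ord_recr IH.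
Qed.

Definition good d := lcost d.+1 <= 2 * lcost d.

Fixpoint lrun d := if d is d'.+1 then if good d' then (lrun d').+1 else 0%N
                   else 0%N.

Lemma lrun_good d e : (d - lrun d <= e < d)%N -> good e.
Proof.
elim: d => [|d IH] /=; first by lia.
case: ifP => Hd; last by lia.
have [->|Hne] := eqVneq e d; first by [].
by move=> He; apply: IH; lia.
Qed.

Let nbad d := (\sum_(e < d) ~~ good e)%N.

(** The hierarchies met among the first [j] blocks. The guard is there because [lblk] keeps growing
    past the last block, where the default cost 0 must not count as a new hierarchy. *)
Let hcount j :=
  ((0 < j) + \sum_(1 <= i < j) ((i < size bs) && (acost bs i != acost bs i.-1)))%N.

Let hcount_le j : (hcount j <= hierarchies bs)%N.
Proof.
rewrite /hcount /hierarchies; apply: leq_add; first by case: j.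
pose F i : nat := (i < size bs)%N && (acost bs i != acost bs i.-1).
rewrite -/(\sum_(1 <= i < j) F i)%N.
have -> : (\sum_(1 <= i < size bs) (acost bs i != acost bs i.-1)
    = \sum_(1 <= i < size bs) F i)%N.
  by apply: eq_big_nat => i /andP[_ Hi]; rewrite /F Hi.
have F0 a b : (size bs <= a)%N -> (\sum_(a <= i < b) F i = 0)%N.
  by move=> Ha; rewrite big_nat big1 // => i /andP[Hi _]; rewrite /F ltnNge
    (leq_trans Ha Hi).
have [Hj|Hj] := leqP j (size bs).
  have [H1|H1] := leqP 1 j; last by rewrite big_geq // ltnW.
  by rewrite (big_cat_nat H1 Hj) leq_addr.
have [H1|H1] := leqP 1 (size bs); last by rewrite F0 // ltnW.
by rewrite (big_cat_nat H1 (ltnW Hj)) /= (F0 (size bs)) // addn0.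
Qed.

(* A bad level opens a block whose cost exceeds that of the block before. *)
Let nbad_le d :
  (nbad d <= hcount (lblk d))%N /\
  ((0 < lblk d)%N -> acost bs (lblk d).-1 <= lcost d).
Proof.
elim: d => [|d [IH1 IH2]]; first by rewrite /nbad big_ord0.
have := lcost_ge0 d; have A0 := acost_ge0 (lblk d) => c0.
have -> : nbad d.+1 = (nbad d + ~~ good d)%N by rewrite /nbad big_ord_recr.
rewrite lblkS lcostS /good lcostS; case: ifPn => Hr.
  have -> : lcost d <= 2 * lcost d by lra.
  by rewrite addn0.
split; last by move=> _ /=; lra.
have step : (hcount (lblk d).+1 = hcount (lblk d)
    + (if lblk d is 0 then 1 else
       (lblk d < size bs) && (acost bs (lblk d) != acost bs (lblk d).-1)))%N.
  rewrite /hcount; case: (lblk d) => [|j]; first by rewrite !big_geq.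
  by rewrite [in LHS]big_nat_recr //= addnA.
rewrite step; apply: leq_add => //.
case: (boolP (_ <= _ * _)) => //=; rewrite -ltNge => Hb.
have q0 : lcost d < acost bs (lblk d) by lra.
case E : (lblk d) => [//|j]; rewrite -E.
(* Past the last block the cost defaults to 0, so a level there cannot be bad. *)
have -> : (lblk d < size bs)%N.
  rewrite ltnNge; apply/negP => K; move: q0; rewrite /acost nth_default //=; lra.
suff -> : acost bs (lblk d) != acost bs (lblk d).-1 by [].
by rewrite gt_eqF // (le_lt_trans _ q0) // IH2 // E.
Qed.

(** As long as every run of good levels is shorter than [H], a bad level together with the run
    before it uses up at most [H] levels. With at most [hierarchies bs] bad levels, a long run must
    end by level [(hierarchies bs).+1 * H]. *)
Lemma lrun_ex H : (0 < H)%N ->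
  exists2 d, (H <= lrun d)%N & (d <= (hierarchies bs).+1 * H)%N.
Proof.
move=> H0; pose B := ((hierarchies bs).+1 * H)%N.
have [/existsP[d Hd]|] := boolP [exists d : 'I_B.+1, (H <= lrun d)%N].
  by exists d => //; rewrite -ltnS.
rewrite negb_exists => /forallP Hno.
have no d : (d <= B)%N -> (lrun d < H)%N.
  by move=> Hd; have := Hno (Ordinal (Hd : (d < B.+1)%N)); rewrite -ltnNge.
have inv d : (d <= B)%N -> (d <= nbad d * H + lrun d)%N.
  elim: d => // d IH Hd; have := IH (ltnW Hd); have := no _ (ltnW Hd).
  have -> : nbad d.+1 = (nbad d + ~~ good d)%N by rewrite /nbad big_ord_recr.
  by rewrite /=; case: ifP => _; rewrite ?addn0 ?addn1 ?mulSn; lia.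
have := inv _ (leqnn _); have := no _ (leqnn _).
have : (nbad B * H <= hierarchies bs * H)%N.
  by rewrite leq_mul2r (leq_trans (nbad_le B).1 (hcount_le _)) orbT.
have EB : B = (H + hierarchies bs * H)%N by rewrite /B mulSn.
move: EB {Hno}; clearbody B; lia.
Qed.

End Levels.

(** * The recurrence *)

Section Smallest.
Variables (R : realType) (n : nat) (F : nat -> R).
Hypothesis F_mono : forall i j, (i <= j < n)%N -> F i <= F j.

(** Both sums have equally many terms, so the threshold [F #|Y|.-1] may be subtracted from each.
    Then the terms on the left are nonpositive, those of [Y] beyond the first [#|Y|] indices are
    nonnegative, and the comparison holds termwise. *)
Lemma sum_smallest (Y : {set 'I_n}) : \sum_(j < #|Y|) F j <= \sum_(i in Y) F i.
Proof.
have kn : (#|Y| <= n)%N by rewrite -[n in (_ <= n)%N]card_ord max_card.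
have [->|[y Hy]] := set_0Vmem Y; first by rewrite cards0 !big_ord0 big_set0.
have k0 : (0 < #|Y|)%N by rewrite card_gt0; apply/set0Pn; exists y.
rewrite (big_ord_widen n F kn); set k := #|Y| in kn k0 *.
pose th := F k.-1.
have E1 : \sum_(i < n | (i < k)%N) th = k%:R * th.
  by rewrite -(big_ord_widen n (fun=> th) kn) sumr_const card_ord mulr_natl.
have E2 : \sum_(i in Y) th = k%:R * th by rewrite sumr_const mulr_natl.
rewrite -(lerD2r (- (k%:R * th))) -{1}E1 -E2 -!sumrB.
rewrite big_mkcond [X in _ <= X]big_mkcond /=; apply: ler_sum => i _.
case: ltnP => Hi.
  have : F i <= th by apply: F_mono; lia.
  by case: ifP => _; lra.
have : th <= F i by apply: F_mono; have := ltn_ord i; lia.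
by case: ifP => _; lra.
Qed.

Variables (f : 'I_n -> R) (sg : 'I_n -> 'I_n).
Hypothesis sg_inj : injective sg.
Hypothesis F_sg : forall i : 'I_n, F i = f (sg i).

Lemma sum_smallest_perm (X : {set 'I_n}) :
  \sum_(j < #|X|) F j <= \sum_(c in X) f c.
Proof.
have -> : \sum_(c in X) f c = \sum_(i in sg @^-1: X) F i.
  rewrite (reindex_inj sg_inj) /=; apply: eq_big => i; first by rewrite inE.
  by rewrite F_sg.
have -> : #|X| = #|sg @^-1: X| by rewrite on_card_preimset //; apply: onW_bij;
  apply: injF_bij.
exact: sum_smallest.
Qed.

(** Summation by levels: the set of characters deeper than [h] weighs at least as much as equally
    many least frequent ones. The left side thus depends on [d] only through the level sizes, which
    is all that the recurrence sees. *)
Lemma layer_cake (C : nat -> R) D (d : 'I_n -> nat) :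
  {homo C : x y / (x <= y)%N >-> x <= y} -> (forall c, d c <= D)%N ->
  \sum_(h < D) (\sum_(j < #|[set c | h < d c]%N|) F j) * (C h.+1 - C h)
    <= \sum_c f c * (C (d c) - C 0).
Proof.
move=> Cm dD.
apply: (@le_trans _ _
    (\sum_(h < D) (\sum_(c | (h < d c)%N) f c) * (C h.+1 - C h))).
  apply: ler_sum => h _; apply: ler_wpM2r; first by rewrite subr_ge0 Cm.
  apply: le_trans (sum_smallest_perm _) _.
  by rewrite le_eqVlt; apply/orP; left; apply/eqP; apply: eq_bigl => c; rewrite inE.
under eq_bigr => h _ do rewrite mulr_suml.
rewrite (exchange_big_dep xpredT) //=; apply: ler_sum => c _.
rewrite -mulr_sumr -(big_ord_widen D (fun h => C h.+1 - C h) (dD c)).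
by rewrite -(big_mkord xpredT (fun h => C h.+1 - C h)) telescope_sumr.
Qed.

End Smallest.

Section DP.
Variables (R : realType) (rk : nat -> nat) (S E : nat -> R).

(** Minimum of two possibly infinite values, with first component 0 standing for infinity. *)
Definition pick2 (l x : nat * R) : nat * R :=
  if (l.1 <= 0)%N then if (x.1 <= 0)%N then (0%N, 0) else (2%N, x.2)
  else if (x.1 <= 0)%N then (1%N, l.2)
  else if l.2 <= x.2 then (1%N, l.2) else (2%N, x.2).

(* [dp g k b r] is for the [k] least frequent characters below [b] nodes, with
   [g] levels and [r] length units left.  The first component tells whether the
   next step makes a leaf (1), splits all nodes (2) or is impossible (0). *)
Fixpoint dp (g : nat) : nat -> nat -> nat -> nat * R :=
  fix aux (k b r : nat) : nat * R :=
    if k is k'.+1 then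
      pick2 (if b is b'.+1 then aux k' b' r else (0%N, 0))
        (if g is g'.+1 then
           if (rk k <= r)%N then
             let y := dp g' k (b + b)%N (r - rk k)%N in
             (y.1, y.2 + S k * E g)
           else (0%N, 0)
         else (0%N, 0))
    else ((1 - b)%N, 0).

Lemma dp0 g b r : dp g 0 b r = ((1 - b)%N, 0).
Proof. by case: g. Qed.

(** This and [dp_split] restate the two branches with tests and truncated subtraction, as the
    program evaluates them. *)
Definition dp_leaf g k b r : nat * R :=
  if (1 <= b)%N then dp g (k - 1) (b - 1) r else (0%N, 0).

Definition dp_split g k b r : nat * R :=
  if (1 <= g)%N then
    if (rk k <= r)%N then
      ((dp (g - 1) k (b + b) (r - rk k)).1,
       (dp (g - 1) k (b + b) (r - rk k)).2 + S k * E g)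
    else (0%N, 0)
  else (0%N, 0).

Lemma dpS g k b r :
  dp g k.+1 b r = pick2 (dp_leaf g k.+1 b r) (dp_split g k.+1 b r).
Proof.
by rewrite /dp_leaf /dp_split; case: g => [|g]; case: b => [|b]; rewrite /= ?subn1.
Qed.

Lemma dp_inf g k b r : (dp g k b r).1 = 0%N -> (dp g k b r).2 = 0.
Proof.
case: k => [|k]; first by rewrite dp0.
by rewrite dpS /pick2; do 3?[case: ifP => _ //].
Qed.

(** Every open node needs at least one character below it. This lets the table stop at [b = n],
    although a split may look up [b + b]. *)
Lemma dp_big g k b r : (k < b)%N -> dp g k b r = (0%N, 0).
Proof.
move=> kb; suff H : (dp g k b r).1 = 0%N.
  by have := dp_inf H; move: H; case: (dp _ _ _ _) => /= ? ? -> ->.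
have step g' k' b' r' : (dp_leaf g' k'.+1 b' r').1 = 0%N ->
    (dp_split g' k'.+1 b' r').1 = 0%N -> (dp g' k'.+1 b' r').1 = 0%N.
  by move=> El Es; rewrite dpS /pick2 El Es.
elim: g k b r kb => [|g IHg]; elim=> [|k IHk] b r kb.
- by rewrite dp0 /=; lia.
- by apply: step => //; rewrite /dp_leaf; case: ifP => // _; rewrite subn1 IHk //; lia.
- by rewrite dp0 /=; lia.
apply: step; first by rewrite /dp_leaf; case: ifP => // _; rewrite subn1 IHk //; lia.
by rewrite /dp_split !subn1 /=; case: ifP => //= _; rewrite IHg //; lia.
Qed.

Variant dp_step g k b r : Prop :=
| DpLeaf of (dp g k.+1 b r).1 = 1%N & (0 < b)%N
    & (dp g k b.-1 r).1 <> 0%N & (dp g k.+1 b r).2 = (dp g k b.-1 r).2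
| DpSplit of (dp g k.+1 b r).1 = 2%N & (0 < g)%N & (rk k.+1 <= r)%N
    & (dp g.-1 k.+1 (b + b) (r - rk k.+1)).1 <> 0%N
    & (dp g k.+1 b r).2
      = (dp g.-1 k.+1 (b + b) (r - rk k.+1)).2 + S k.+1 * E g.

Lemma dp_stepP g k b r : (dp g k.+1 b r).1 <> 0%N -> dp_step g k b r.
Proof.
move=> H; move: (H); rewrite dpS /pick2.
have Lf : ~~ ((dp_leaf g k.+1 b r).1 <= 0)%N ->
    (dp g k.+1 b r) = (1%N, (dp_leaf g k.+1 b r).2) -> dp_step g k b r.
  rewrite /dp_leaf !subn1 /=; case: ifP => // b0 Hl E1.
  by apply: DpLeaf; rewrite ?E1 //= => K; rewrite K in Hl.
have Sp : ~~ ((dp_split g k.+1 b r).1 <= 0)%N ->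
    (dp g k.+1 b r) = (2%N, (dp_split g k.+1 b r).2) -> dp_step g k b r.
  rewrite /dp_split !subn1; case: ifP => // g0; case: ifP => // Hr Hl E1.
  by apply: DpSplit; rewrite ?E1 //= => K; rewrite /= K in Hl.
move: Lf Sp; rewrite dpS /pick2.
case: ifPn => Hl; case: ifPn => Hx //.
- by move=> _ Sp _; apply: Sp.
- by move=> Lf _ _; apply: Lf.
- by case: ifPn => _ Lf Sp _; [apply: Lf|apply: Sp].
Qed.

Lemma dp_leaf_le g k b r : (dp g k b r).1 <> 0%N ->
  (dp g k.+1 b.+1 r).1 <> 0%N /\ (dp g k.+1 b.+1 r).2 <= (dp g k b r).2.
Proof.
move=> H; have Ed : dp_leaf g k.+1 b.+1 r = dp g k b r by rewrite /dp_leaf !subn1.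
rewrite dpS /pick2 Ed; have -> : ((dp g k b r).1 <= 0)%N = false by lia.
case: ifP => // _; case: ifPn => //=; rewrite -ltNge => /ltW //.
Qed.

Lemma dp_split_le g k b r : (0 < k)%N -> (rk k <= r)%N ->
  (dp g k (b + b) (r - rk k)).1 <> 0%N ->
  (dp g.+1 k b r).1 <> 0%N /\
  (dp g.+1 k b r).2 <= (dp g k (b + b) (r - rk k)).2 + S k * E g.+1.
Proof.
case: k => // k _ Hr H; rewrite dpS /pick2 /dp_split !subn1 /= Hr.
have -> /= : ((dp g k.+1 (b + b) (r - rk k.+1)).1 <= 0)%N = false by lia.
by case: ifP => // _; case: ifPn.
Qed.

Lemma dp_leaves_le g k b r i : (dp g k b r).1 <> 0%N ->
  (dp g (k + i) (b + i) r).1 <> 0%N /\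
  (dp g (k + i) (b + i) r).2 <= (dp g k b r).2.
Proof.
move=> H; elim: i => [|i [IH1 IH2]]; first by rewrite !addn0.
rewrite !addnS; have [K1 K2] := dp_leaf_le IH1; split=> //.
exact: le_trans K2 IH2.
Qed.

Section Complete.
Variables (n D : nat) (C : nat -> R) (d : 'I_n -> nat).
Hypothesis dD : forall c, (d c <= D)%N.
Hypothesis C_mono : {homo C : x y / (x <= y)%N >-> x <= y}.
Hypothesis S_ge0 : forall k, (k <= n)%N -> 0 <= S k.
Hypothesis E_C : forall g, (0 < g <= D)%N -> E g = C (D - g).+1 - C (D - g)%N.

Let A h := #|[set c | h <= d c]%N|.
Let K h := (\sum_(c | h <= d c) 2 ^ (D - d c))%N.

(** The recurrence can imitate [d] from level [D - g] on: it makes as many leaves as [d] has at the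
    level, then splits. The Kraft equality of the part below the level determines the number [b] of
    open nodes. *)
Lemma dp_complete_aux g : (g <= D)%N -> forall b r,
  (b * 2 ^ g = K (D - g))%N ->
  (\sum_(D - g <= h < D) rk (A h.+1) <= r)%N ->
  (dp g (A (D - g)) b r).1 <> 0%N /\
  (dp g (A (D - g)) b r).2
    <= \sum_(D - g <= h < D) S (A h.+1) * (C h.+1 - C h).
Proof.
have Asplit h : A h = (A h.+1 + #|[set c | d c == h]|)%N.
  rewrite -cardsUI [X in (_ + #|pred_of_set X|)%N](_ : _ = set0) ?cards0 ?addn0.
    by apply: eq_card => c; rewrite !inE leq_eqVlt eq_sym orbC.
  by apply/setP => c; rewrite !inE; case: eqP => [->|]; rewrite ?ltnn ?andbF.
have Ksplit h : K h = (K h.+1 + #|[set c | d c == h]| * 2 ^ (D - h))%N.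
  rewrite /K (bigID (fun c => d c == h)) /= addnC; congr (_ + _)%N.
    by apply: eq_bigl => c; rewrite [in RHS]ltn_neqAle eq_sym andbC.
  rewrite -sum_nat_const; apply: eq_big => c.
    by rewrite inE; case: eqP => [->|]; rewrite ?leqnn ?andbF.
  by case/andP=> _ /eqP ->.
have An h : (A h <= n)%N by rewrite -[n in (_ <= n)%N]card_ord max_card.
have KA h : A h = 0%N -> K h = 0%N.
  move/eqP; rewrite cards_eq0 => /eqP/setP H; rewrite /K big_pred0 // => c.
  by have := H c; rewrite !inE.
have top : A D.+1 = 0%N.
  apply/eqP; rewrite cards_eq0; apply/eqP/setP => c.
  by rewrite !inE; apply/negbTE; rewrite -ltnNge ltnS.
elim: g => [|g IH] Hg b r.
  rewrite subn0 Ksplit subnn expn0 !muln1 (KA _ top) add0n => -> _.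
  rewrite Asplit top; have := @dp_leaves_le 0 0 0 r #|[set c | d c == D]|.
  by rewrite dp0 /= big_geq //; apply.
set h := (D - g.+1)%N; have hS : (D - g = h.+1)%N by rewrite /h; lia.
have Dh : (D - h = g.+1)%N by rewrite /h; lia.
set l := #|[set c | d c == h]|.
rewrite Ksplit Dh -/l => Eb Hr.
have hD : (h < D)%N by rewrite /h; lia.
have lb : (l <= b)%N.
  by rewrite -(leq_pmul2r (expn_gt0 2 g.+1)) Eb leq_addl.
pose b' := (b - l)%N; have bE : b = (b' + l)%N by rewrite subnK.
have Eb' : ((b' + b') * 2 ^ g = K h.+1)%N.
  move: Eb; rewrite {1}bE mulnDl => /addIn <-.
  by rewrite expnS mulnA; congr (_ * _)%N; lia.
rewrite big_ltn // in Hr; rewrite [X in _ /\ _ <= X]big_ltn //.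
rewrite Asplit -/l {1 2}bE.
have pos : 0 <= \sum_(h.+1 <= i < D) S (A i.+1) * (C i.+1 - C i).
  by apply: sumr_ge0 => i _; rewrite mulr_ge0 ?S_ge0 // subr_ge0 C_mono.
have posh : 0 <= S (A h.+1) * (C h.+1 - C h).
  by rewrite mulr_ge0 ?S_ge0 // subr_ge0 C_mono.
suff [K1 K2] : (dp g.+1 (A h.+1) b' r).1 <> 0%N /\
    (dp g.+1 (A h.+1) b' r).2 <= S (A h.+1) * (C h.+1 - C h) +
      \sum_(h.+1 <= i < D) S (A i.+1) * (C i.+1 - C i).
  have [L1 L2] := dp_leaves_le l K1; split=> //; exact: le_trans L2 K2.
(* With no deeper character, the Kraft equality leaves no open node either, and the cell is the
   successful base case. *)
have [A0|A0] := posnP (A h.+1).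
  have b0 : b' = 0%N.
    move: Eb'; rewrite (KA _ A0) => /eqP; rewrite muln_eq0.
    by have := expn_gt0 2 g; lia.
  by move: posh; rewrite A0 b0 dp0 /= => posh; split=> //; lra.
have [|| L1 L2] := IH (ltnW Hg) (b' + b')%N (r - rk (A h.+1))%N.
- by rewrite hS.
- by rewrite hS; lia.
rewrite hS in L1 L2.
have [|M1 M2] := dp_split_le A0 _ L1; first by lia.
split=> //; apply: le_trans M2 _; rewrite E_C; last by lia.
by rewrite -/h; lra.
Qed.

Theorem dp_complete r : (\sum_c 2 ^ (D - d c) = 2 ^ D)%N ->
  (\sum_(h < D) rk #|[set c | h < d c]%N| <= r)%N ->
  (dp D n 1 r).1 <> 0%N /\
  (dp D n 1 r).2 <= \sum_(h < D) S #|[set c | h < d c]%N| * (C h.+1 - C h).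
Proof.
move=> EK Hr; have := @dp_complete_aux D (leqnn D) 1%N r.
have K0 : K 0 = (2 ^ D)%N by rewrite -EK; apply: eq_bigl.
rewrite subnn mul1n K0 => /(_ erefl).
rewrite !big_mkord => /(_ Hr); rewrite (_ : A 0 = n) //.
by rewrite /A -[RHS]card_ord; apply: eq_card => c; rewrite !inE.
Qed.

End Complete.

Section Sound.
Variables (D : nat) (C F : nat -> R) (Y : R).

(** Here [e j] is the depth of the [j]-th least frequent character. Cost and length are counted from
    level [D - g], where the cell begins. The unit of length is [Y / D]; multiplying by [D] keeps
    the last clause free of division. *)
Record witness (g k b r : nat) (v : R) (e : nat -> nat) : Prop := Witness {
  wit_range : forall j, (j < k)%N -> (D - g <= e j <= D)%N;
  wit_mono : forall i j, (i <= j < k)%N -> (e j <= e i)%N;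
  wit_kraft : (b * 2 ^ g = \sum_(j < k) 2 ^ (D - e j))%N;
  wit_cost : \sum_(j < k) F j * (C (e j) - C (D - g)%N) = v;
  wit_len : (\sum_(j < k) F j * (e j - (D - g))%:R) * D%:R <= r%:R * Y }.

Lemma witness0 g r e : 0 <= Y -> witness g 0 0 r 0 e.
Proof.
by move=> Y0; split=> //; rewrite ?big_ord0 // ?mul0r ?mulr_ge0 // => i j; lia.
Qed.

Lemma witness_leaf g k b r v e : (g <= D)%N -> witness g k b r v e ->
  e k = (D - g)%N -> witness g k.+1 b.+1 r v e.
Proof.
move=> gD [Hr Hm Hk Hc Hl] ek; split.
- move=> j; rewrite ltnS leq_eqVlt => /orP[/eqP->|/Hr//]; lia.
- move=> i j /andP[ij]; rewrite ltnS leq_eqVlt => /orP[/eqP Ej|Hj]; last first.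
    by apply: Hm; rewrite ij.
  move: ij; rewrite Ej leq_eqVlt => /orP[/eqP->//|/Hr]; lia.
- by rewrite big_ord_recr /= -Hk ek mulSn addnC; congr (_ + 2 ^ _)%N; lia.
- by rewrite big_ord_recr /= Hc ek subrr mulr0 addr0.
- by rewrite big_ord_recr /= ek subnn mulr0 addr0.
Qed.

Lemma witness_split g k b r v e : (g < D)%N -> S k = \sum_(j < k) F j ->
  witness g k (b + b) (r - rk k) v e -> (rk k <= r)%N ->
  S k * D%:R <= (rk k)%:R * Y ->
  witness g.+1 k b r (v + S k * (C (D - g)%N - C (D - g.+1)%N)) e.
Proof.
move=> gD S_F [Hr Hm Hk Hc Hl] Hrk HS; split.
- move=> j /Hr; lia.
- by [].
- by rewrite -Hk expnS mulnA; congr (_ * _)%N; lia.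
- rewrite -Hc S_F mulr_suml -big_split /=; apply: eq_bigr => j _; ring.
have -> : \sum_(j < k) F j * (e j - (D - g.+1))%:R
    = \sum_(j < k) F j * (e j - (D - g))%:R + S k.
  rewrite S_F -big_split /=; apply: eq_bigr => j _.
  rewrite -{3}[F j]mulr1 -mulrDr natr1; congr (_ * _%:R).
  by have := Hr _ (ltn_ord j); lia.
by move: Hl; rewrite natrB // mulrBl mulrDl; lra.
Qed.

End Sound.
End DP.

(** * Trees from sorted sequences of depths *)

Section Forest.
Variable n : nat.
Implicit Types (T : tree n) (st : seq nat) (ts : seq (tree n)).

Fixpoint leaf_depths c T : seq ('I_n * nat) :=
  match T with
  | Leaf x => [:: (x, c)]
  | Node l r => leaf_depths c.+1 l ++ leaf_depths c.+1 r
  end.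

Lemma leaf_depthsE c T : uniq (leaves T) ->
  leaf_depths c T = [seq (x, (c + depth T x)%N) | x <- leaves T].
Proof.
elim: T c => [x|l IHl r IHr] c /= u; first by rewrite addn0.
move: (u); rewrite cat_uniq => /and3P[ul /hasPn H ur].
rewrite map_cat IHl // IHr //; congr (_ ++ _); apply/eq_in_map => x Hx.
  by rewrite Hx addSnnS.
by rewrite (negbTE (H _ Hx)) addSnnS.
Qed.

Lemma map_leaf_depths c T : map fst (leaf_depths c T) = leaves T.
Proof. by elim: T c => //= l IHl r IHr c; rewrite map_cat IHl IHr. Qed.

Fixpoint forest_depths st ts : seq ('I_n * nat) :=
  match st, ts with
  | c :: st', t :: ts' => leaf_depths c t ++ forest_depths st' ts'
  | _, _ => [::]
  end.

(* Canonical codes: reading the characters by increasing depth, the leftmost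
   open node is never deeper than the next character. *)
Lemma forest_exists D st (ls : seq ('I_n * nat)) :
  sorted leq (map snd ls) -> all (fun p => p.2 <= D)%N ls ->
  {in st & ls, forall c p, (c <= p.2)%N} ->
  (\sum_(c <- st) 2 ^ (D - c) = \sum_(p <- ls) 2 ^ (D - p.2))%N ->
  exists2 ts, size ts = size st & forest_depths st ts = ls.
Proof.
(* The summand is the number of nodes of a complete binary tree of height [D - c]; making a leaf or
   splitting a node lowers the total. *)
have [m] := ubnP (\sum_(c <- st) (2 ^ (D - c) * 2).-1)%N.
elim: m => // m IH in st ls *; rewrite ltnS.
case: st => [|c st] Hm srt lsD le_st Ek.
  exists [::] => //; case: ls Ek {srt lsD le_st} => // p ls.
  by rewrite big_nil big_cons; have := expn_gt0 2 (D - p.2); lia.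
case: ls srt lsD le_st Ek => [|[x d] ls] srt lsD le_st.
  by rewrite big_nil big_cons; have := expn_gt0 2 (D - c); lia.
have cd : (c <= d)%N by apply: (le_st c (x, d)); rewrite mem_head.
move: lsD => /= /andP[dD lsD]; rewrite !big_cons /= => Ek.
have lsd p : p \in ls -> (d <= p.2)%N.
  move=> Hp; move: srt => /=; rewrite (path_sortedE leq_trans) => /andP[/allP H _].
  by apply: H; apply: map_f.
rewrite big_cons in Hm; have ec := expn_gt0 2 (D - c).
have [E|NE] := eqVneq c d.
  subst d; have [|||||ts Hs Hf] := IH st ls.
  - by lia.
  - exact: path_sorted srt.
  - by [].
  - by move=> a p Ha Hp; apply: le_st; rewrite in_cons ?Ha ?Hp orbT.
  - by lia.
  by exists (Leaf x :: ts); rewrite /= ?Hs ?Hf.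
have half : (2 ^ (D - c) = 2 ^ (D - c.+1) * 2)%N.
  by rewrite -expnSr; congr (2 ^ _)%N; lia.
have ec' := expn_gt0 2 (D - c.+1).
have [|||||ts Hs Hf] := IH [:: c.+1, c.+1 & st] ((x, d) :: ls).
- by rewrite !big_cons; lia.
- by [].
- by rewrite /= dD.
- move=> a p; rewrite !in_cons orbA orbb => /orP[/eqP->|Ha].
    case/orP=> [/eqP->|/lsd] /=; lia.
  by move=> Hp; apply: le_st; rewrite in_cons ?Ha ?orbT.
- by rewrite !big_cons /=; lia.
case: ts Hs Hf => [|l [|r ts]] //= [Hs] Hf.
by exists (Node l r :: ts); rewrite /= ?Hs // -catA.
Qed.

End Forest.

(** * The program *)

Local Notation "# k" := (ICst k) (at level 2, format "# k").
Local Notation "x +! y" := (IAdd x y) (at level 50, left associativity).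
Local Notation "x -! y" := (ISub x y) (at level 50, left associativity).
Local Notation "x *! y" := (IMul x y) (at level 40, left associativity).

(* Memory layout.  Natural scalars (entry 0 of the array): 3 number of candidate
   subtrees, 4 a power of two, 5 its logarithm, 6 the depth bound D, 7 length of
   the current run of good levels, 8 blocks opened, 9 levels left in the last
   block, 10 length budget, 13 a rank, 19 base of the table index, 25 and 26
   choices of the two subcells, 27-30 current cell of the trace, 32 stack height,
   34 characters left, 35 output position; 11, 12, 15, 17, 18 and 20-23 are loop
   counters.  Natural arrays: 14 characters by increasing frequency, 16 rounded
   prefix sums, 24 choices, 31 depths, 33 stack of depths of pending nodes.
   Real arrays: 3 cost of a depth, 4 prefix sums, 5 values of the cells; 6 and 7
   are the scalars that go with 25 and 26. *)

Section Phases.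
Variable R : realType.
Implicit Types s : state R.

Definition set_var a e := ISet a #0 e.

(** The machine cannot round reals, so the floor of a quotient is found by counting up to it; the
    same is done for the length budget. *)
Definition count_groups :=
  While (TRLe (RMul (ROfI (IV 3)) (RGet 0 #1)) (RCst 2)) (incr 3).

Lemma count_groups_ok s : 0 < rarr s 0 1 -> iarr s 3 0 = 0%N ->
  let J := (Num.truncn (2 / rarr s 0 1)).+1 in
  ends count_groups s (fun s' => iarr s' 3 0 = J) (50 * J.+1).
Proof.
set dl := rarr s 0 1 => d0 H0 J.
have Q0 : 0 <= 2 / dl by rewrite divr_ge0 // ltW.
apply: ends_le; last first.
  apply: (@ends_while _ _ _ _ J _ (fun i s' => iarr s' 3 0 = i)) => //.
    move=> i s' Hi F E; split.
      by rewrite /= E F.2 // -/dl -ler_pdivlMr // -truncn_ge_nat.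
    by apply: ends_straight => //=; rewrite /upd /= E addn1.
  move=> s' F E; rewrite /= E F.2 // -/dl -ler_pdivlMr // -truncn_ge_nat //.
  by rewrite -ltnNge.
by rewrite /=; lia.
Qed.

Definition log_size :=
  Seq (set_var 4 #1)
      (While (TILe (IV 4 +! #1) (IV 0))
             (Seq (set_var 4 (IV 4 +! IV 4)) (incr 5))).

Lemma log_size_ok s n : iarr s 0 0 = n -> iarr s 5 0 = 0%N ->
  let lam := up_log 2 n in
  ends log_size s (fun s' => iarr s' 5 0 = lam) (50 * lam.+1).
Proof.
move=> Hn H0 lam.
apply: ends_le; last first.
  apply: (@ends_seq _ _ _ _ (fun s' => [/\ iarr s' 4 0 = 1%N, iarr s' 5 0 = 0%N
    & iarr s' 0 0 = n])).
    by apply: ends_straight.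
  move=> s1 _ [E4 E5 E0].
  apply: (@ends_imp _ _ _ (fun s' => iarr s' 4 0 = (2 ^ lam)%N /\
      iarr s' 5 0 = lam)) (leqnn _) _; first by move=> ? _ [].
  apply: (@ends_while _ _ _ _ lam _ (fun i s' => iarr s' 4 0 = (2 ^ i)%N /\
      iarr s' 5 0 = i)) => //.
    move=> i s' Hi F [E1 E2]; split.
      rewrite /= E1 F.1 // E0 addn1 ltnNge; apply/negP => K.
      by have := up_log_min (isT : (1 < 2)%N) K; rewrite -/lam; lia.
    apply: ends_straight => //=; rewrite /upd /= E1 E2 addn1; split=> //.
    by rewrite expnS mul2n addnn.
  by move=> s' F [E1 E2]; rewrite /= E1 F.1 // E0 addn1 -leqNgt up_logP.
by rewrite /=; lia.
Qed.

(** The number of hierarchies is never computed: the scan stops at the first sufficiently long run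
    of good levels, and [lrun_ex] bounds how far away that is. *)
Definition scan_levels :=
  While (TILe (IV 7 +! #1) (IV 3 +! IV 5 +! #2))
    (Seq
      (If (TILe #1 (IV 9))
         (Seq (RSet 3 (IV 6 +! #1) (RGet 3 (IV 6))) (set_var 9 (IV 9 -! #1)))
         (Seq (RSet 3 (IV 6 +! #1) (RAdd (RGet 3 (IV 6)) (RGet 2 (IV 8))))
              (Seq (set_var 9 (IGet 1 (IV 8) -! #1)) (incr 8))))
      (Seq
        (If (TRLe (RGet 3 (IV 6 +! #1)) (RMul (RCst 2) (RGet 3 (IV 6))))
            (incr 7) (set_var 7 #0))
        (incr 6))).

Lemma scan_levels_ok s (bs : scheme R) H D :
  (forall j, iarr s 1 j = width bs j) -> (forall j, rarr s 2 j = acost bs j) ->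
  (iarr s 3 0 + iarr s 5 0 + 2)%N = H ->
  (forall a, (6 <= a <= 9)%N -> iarr s a 0 = 0%N) -> rarr s 3 0 = 0 ->
  (H <= lrun bs D)%N -> (forall d, (d < D)%N -> (lrun bs d < H)%N) ->
  ends scan_levels s
    (fun s' => iarr s' 6 0 = D /\ forall d, (d <= D)%N -> rarr s' 3 d = lcost bs d)
    (200 * D.+1).
Proof.
move=> Hw Hq HH H0 C0 HD Hlt.
pose I d s' := [/\ iarr s' 6 0 = d /\ iarr s' 7 0 = lrun bs d,
  iarr s' 8 0 = lblk bs d, iarr s' 9 0 = lrem bs d
  & forall e, (e <= d)%N -> rarr s' 3 e = lcost bs e].
apply: ends_le; last first.
  apply: (@ends_imp _ _ _ (I D)) (leqnn _) _; first by move=> s' _ [[]].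
  apply: (@ends_while _ _ _ _ D _ I).
  - split; rewrite ?H0 //.
    by move=> e; rewrite leqn0 => /eqP ->; exact: C0.
  - move=> d s' Hd F [[E6 E7] E8 E9 EC]; split.
      by rewrite /= E7 !F.1 // HH addn1; apply: Hlt.
    have Ed : rarr s' 3 d = lcost bs d by rewrite EC.
    apply: (@ends_seq _ _ _ _ (fun s1 => [/\ iarr s1 6 0 = d /\
        iarr s1 7 0 = lrun bs d, iarr s1 8 0 = lblk bs d.+1,
        iarr s1 9 0 = lrem bs d.+1
        & forall e, (e <= d.+1)%N -> rarr s1 3 e = lcost bs e])).
      have Eq : rarr s' 2 (iarr s' 8 0) = acost bs (lblk bs d).
        by rewrite F.2 // Hq E8.
      have Ew : iarr s' 1 (iarr s' 8 0) = width bs (lblk bs d).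
        by rewrite F.1 // Hw E8.
      apply: ends_straight => //.
      rewrite lblkS lremS /= E9; case: ifPn => Hr /=.
        split=> // e He; rewrite /upd /= E6 addn1; case: eqP => [->|Hne].
          by rewrite Ed lcostS Hr.
        by apply: EC; lia.
      split; rewrite /= ?Ew /upd //= ?E8 ?addn1 //.
      move=> e He; rewrite /= ?E6 ?addn1; case: eqP => [->|Hne].
        by rewrite Ed -E8 Eq lcostS (negbTE Hr).
      by apply: EC; lia.
    move=> s1 _ [[F6 F7] F8 F9 FC]; apply: ends_straight => //.
    rewrite /= F6 addn1 !FC // -/(good bs d); case: ifP => Hg /=;
      by split; rewrite //= /upd /= ?F6 ?F7 ?addn1 // /lrun -/(lrun bs) Hg.
  by move=> s' F [[E6 E7] _ _ _]; rewrite /= E7 !F.1 // HH addn1 -leqNgt.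
by rewrite /=; lia.
Qed.

Definition round_budget :=
  Seq (While (TRLe (RMul (ROfI (IV 10 +! #1)) (RGet 0 #0)) (ROfI (IV 6)))
             (incr 10))
      (set_var 10 (IV 10 +! IV 6)).

Lemma round_budget_ok s D ep : 0 < ep -> rarr s 0 0 = ep -> iarr s 10 0 = 0%N ->
  iarr s 6 0 = D ->
  let u := Num.truncn (D%:R / ep) in
  ends round_budget s (fun s' => iarr s' 10 0 = (u + D)%N) (50 * u.+1).
Proof.
move=> e0 Hep H0 HD u.
have Q0 : 0 <= D%:R / ep by rewrite divr_ge0 // ltW.
apply: ends_le; last first.
  apply: (@ends_seq _ _ _ _ (fun s' => iarr s' 10 0 = u)).
    apply: (@ends_while _ _ _ _ u _ (fun i s' => iarr s' 10 0 = i)) => //.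
      move=> i s' Hi F E; split.
        by rewrite /= E F.1 // F.2 // HD Hep -ler_pdivlMr // -truncn_ge_nat // addn1.
      by apply: ends_straight => //=; rewrite /upd /= E addn1.
    move=> s' F E; rewrite /= E F.1 // F.2 // HD Hep -ler_pdivlMr //.
    by rewrite -truncn_ge_nat // addn1 ltnn.
  move=> s1 F E; apply: ends_straight => //.
  by rewrite /= /upd /= E F.1 // HD.
by rewrite /=; lia.
Qed.

(** Breaking ties by index gives a strict total order, so that ranks are distinct and sorting
    amounts to counting predecessors. Its quadratic time is absorbed by that of the table. The
    nested tests mirror those of the program. *)
Definition before (F : nat -> R) (j i : nat) : bool :=
  if F i <= F j then if F j <= F i then (j < i)%N else false else true.

Definition rank (F : nat -> R) n i := (\sum_(j < n) before F j i)%N.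

Definition sort_chars :=
  For 11 (IV 0)
    (Seq (Seq (set_var 13 #0)
              (For 12 (IV 0)
                 (If (TRLe (RGet 1 (IV 11)) (RGet 1 (IV 12)))
                     (If (TRLe (RGet 1 (IV 12)) (RGet 1 (IV 11)))
                         (If (TILe (IV 12 +! #1) (IV 11)) (incr 13) Skip)
                         Skip)
                     (incr 13))))
         (ISet 14 (IV 13) (IV 11))).

Lemma beforeE F i j : before F i j = (F i < F j) || (F i == F j) && (i < j)%N.
Proof. by rewrite /before; case: (ltgtP (F i) (F j)). Qed.

Lemma before_total F i j : i <> j -> before F i j || before F j i.
Proof.
move=> ij; rewrite !beforeE; case: (ltgtP (F i) (F j)) => //= _; lia.
Qed.

Lemma before_trans F : transitive (before F).
Proof.
move=> j i k; rewrite !beforeE.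
case: (ltgtP (F i) (F j)) => //= Hij; case: (ltgtP (F j) (F k)) => //= Hjk.
- by rewrite (lt_trans Hij Hjk).
- by rewrite -Hjk Hij.
- by rewrite Hij Hjk.
- by rewrite Hij Hjk ltxx eqxx /=; apply: ltn_trans.
Qed.

Lemma rank_lt F n i j : (i < n)%N -> before F i j -> (rank F n i < rank F n j)%N.
Proof.
move=> Hi Hij; rewrite /rank (bigD1 (Ordinal Hi)) //=.
rewrite [X in (_ < X)%N](bigD1 (Ordinal Hi)) //= Hij.
have -> : before F i i = false by rewrite /before lexx ltnn.
rewrite add0n add1n ltnS; apply: leq_sum => k _.
case: (boolP (before F k i)) => // Hki.
by rewrite (before_trans Hki Hij).
Qed.

Lemma rank_bound F n i : (i < n)%N -> (rank F n i < n)%N.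
Proof.
move=> Hi; rewrite /rank (bigD1 (Ordinal Hi)) //=.
have -> : before F i i = false by rewrite /before lexx ltnn.
rewrite add0n.
apply: (@leq_ltn_trans (\sum_(k < n | k != Ordinal Hi) 1)%N).
  by apply: leq_sum => k _; apply: leq_b1.
rewrite sum1_card cardC1 card_ord; lia.
Qed.

Lemma rank_perm F n (pi : nat -> nat) :
  (forall i, (i < n)%N -> pi (rank F n i) = i) ->
  exists2 sg : 'I_n -> 'I_n, injective sg & [/\ forall i : 'I_n, pi i = sg i
    & forall i j, (i <= j < n)%N -> F (pi i) <= F (pi j)].
Proof.
move=> Hpi; pose rk (i : 'I_n) : 'I_n := Ordinal (rank_bound F (ltn_ord i)).
have rk_inj : injective rk.
  move=> i j /(congr1 val) /= E; apply: val_inj => /=.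
  by rewrite -[LHS]Hpi // -[RHS]Hpi // E.
have rkK := f_invF rk_inj; have Kir := invF_f rk_inj.
have piE (i : 'I_n) : pi i = invF rk_inj i.
  by rewrite -{1}(rkK i) /= Hpi.
exists (invF rk_inj); first by move=> i j /(congr1 rk); rewrite !rkK.
split=> // i j /andP[ij jn]; have iN := leq_ltn_trans ij jn.
rewrite (piE (Ordinal iN)) (piE (Ordinal jn)) leNgt; apply/negP => K.
set a := invF _ _ in K; set b := invF _ _ in K.
have := @rank_lt F n a b (ltn_ord _).
rewrite beforeE K /= => /(_ isT).
have -> : rank F n a = j by rewrite -[RHS]/(val (Ordinal jn)) -(rkK (Ordinal jn)).
have -> : rank F n b = i by rewrite -[RHS]/(val (Ordinal iN)) -(rkK (Ordinal iN)).
lia.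
Qed.

Lemma sort_chars_ok s n : iarr s 0 0 = n ->
  ends sort_chars s (fun s' => forall i, (i < n)%N ->
    iarr s' 14 (rank (rarr s 1) n i) = i) (100 * n.+1 * n.+1).
Proof.
set F := rarr s 1 => Hn.
have rank_in i j : (i < n)%N -> (j < n)%N -> rank F n i = rank F n j -> i = j.
  move=> Hi Hj E; apply/eqP; case: eqP => // /(before_total F) /orP[].
    by move/(rank_lt Hi); rewrite E ltnn.
  by move/(rank_lt Hj); rewrite E ltnn.
apply: ends_le; last first.
  apply: (@ends_for _ _ _ _ _ n _ (fun i s' => forall j, (j < i)%N ->
      iarr s' 14 (rank F n j) = j)) => //.
    by move=> s' Fr; rewrite /= Fr.1.
  move=> i s1 Hi F1 E1 Is.
  apply: (@ends_seq _ _ _ _ (fun s2 => iarr s2 13 0 = rank F n i /\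
    iarr s2 11 0 = i /\ forall j, (j < i)%N -> iarr s2 14 (rank F n j) = j)).
    apply: (@ends_seq _ _ _ _ (fun s2 => iarr s2 13 0 = 0%N)).
      exact: ends_straight.
    move=> s2 F2 E2.
    apply: (@ends_imp _ _ _ (fun s3 => iarr s3 13 0 = rank F n i)) (leqnn _) _.
      move=> s3 F3 ->; split=> //; rewrite F3.1 // F2.1 //; split=> // j Hj.
      by rewrite F3.1 // F2.1 // Is.
    apply: (@ends_for _ _ _ _ _ n _
      (fun j s3 => iarr s3 13 0 = \sum_(k < j) before F k i)%N) => //.
    - by move=> s' Fr; rewrite /= Fr.1 // F2.1 // F1.1.
    - by rewrite big_ord0.
    move=> j s3 Hj F3 E3 Is3; apply: ends_straight => //.
    have -> : (\sum_(k < j.+1) before F k i = \sum_(k < j) before F k i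
        + before F j i)%N by rewrite big_ord_recr.
    have E11 : iarr s3 11 0 = i by rewrite F3.1 // F2.1.
    have EF k : rarr s3 1 k = F k by rewrite F3.2 // F2.2 // F1.2.
    rewrite /= E3 E11 !EF /before addn1.
    by do 3?[case: ifP => _]; rewrite /= /upd /= Is3 ?addn0 ?addn1.
  move=> s2 F2 [E13 [E11 Hj]]; apply: ends_straight => //= j.
  rewrite ltnS leq_eqVlt /upd /= E13 E11.
  case: eqP => [-> _|_ /= ji]; first by rewrite eqxx.
  by case: eqP => [/rank_in ->|_] //; [lia|exact: Hj].
by rewrite /=; nia.
Qed.

Definition prefix_sums :=
  For 15 (IV 0)
    (RSet 4 (IV 15 +! #1) (RAdd (RGet 4 (IV 15)) (RGet 1 (IGet 14 (IV 15))))).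

Lemma prefix_sums_ok s n : iarr s 0 0 = n -> rarr s 4 0 = 0 ->
  ends prefix_sums s (fun s' => forall k, (k <= n)%N ->
    rarr s' 4 k = \sum_(j < k) rarr s 1 (iarr s 14 j)) (100 * n.+1).
Proof.
move=> Hn H0; apply: ends_le; last first.
  apply: (@ends_for _ _ _ _ _ n _ (fun i s' => forall k, (k <= i)%N ->
    rarr s' 4 k = \sum_(j < k) rarr s 1 (iarr s 14 j))) => //.
  - by move=> s' Fr; rewrite /= Fr.1.
  - by move=> k; rewrite leqn0 => /eqP ->; rewrite big_ord0.
  move=> i s' Hi F E Is; apply: ends_straight => // k Hk.
  rewrite /= /upd /= E addn1; case: eqP => [->|Hne]; last by apply: Is; lia.
  by rewrite big_ord_recr /= Is // F.1 // F.2.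
by rewrite /=; lia.
Qed.

Definition length_unit :=
  RMul (RGet 0 #0) (RMul (RAdd (RCst 1) (RGet 0 #1)) (RGet 0 #2)).

Definition round_sums :=
  For 17 (IV 0 +! #1)
    (For 18 (IV 10 +! #1)
       (If (TRLe (RMul (RGet 4 (IV 17)) (ROfI (IV 6)))
                 (RMul (ROfI (IGet 16 (IV 17))) length_unit))
           Skip
           (ISet 16 (IV 17) (IGet 16 (IV 17) +! #1)))).

(** The ceiling of [x / y], stated without division because [y] may be 0. Above [U] only the first
    clause remains: such an amount exceeds the whole budget. *)
Definition rounded (x y : R) (U r : nat) :=
  ((0 < r)%N -> r.-1%:R * y < x) /\ ((r <= U)%N -> x <= r%:R * y).

Lemma round_sums_ok s n U : iarr s 0 0 = n -> iarr s 10 0 = U ->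
  (forall k, iarr s 16 k = 0%N) ->
  let Y := rarr s 0 0 * ((1 + rarr s 0 1) * rarr s 0 2) in
  ends round_sums s (fun s' => forall k, (k <= n)%N ->
    rounded (rarr s 4 k * (iarr s 6 0)%:R) Y U (iarr s' 16 k))
    (100 * n.+2 * U.+2).
Proof.
move=> Hn HU H0 Y.
pose X k := rarr s 4 k * (iarr s 6 0)%:R.
apply: ends_le; last first.
  apply: (@ends_imp _ _ _ (fun s' => (forall k, (k < n + 1)%N ->
    rounded (X k) Y U (iarr s' 16 k)) /\
    (forall k, (n + 1 <= k)%N -> iarr s' 16 k = 0%N))) (leqnn _) _.
    by move=> s' _ [H _] k Hk; apply: H; rewrite addn1.
  apply: (@ends_for _ _ _ _ _ (n + 1) _ (fun i s' => (forall k, (k < i)%N ->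
    rounded (X k) Y U (iarr s' 16 k)) /\
    (forall k, (i <= k)%N -> iarr s' 16 k = 0%N))) => //.
    by move=> s' F; rewrite /= F.1 // Hn.
  move=> i s1 Hi F1 E1 [I1 I2].
  apply: (@ends_imp _ _ _ (fun s' => [/\ (forall k, k <> i ->
      iarr s' 16 k = iarr s1 16 k), (0 < iarr s' 16 i)%N ->
      (iarr s' 16 i).-1%:R * Y < X i, (iarr s' 16 i <= U + 1)%N &
      (iarr s' 16 i < U + 1)%N -> X i <= (iarr s' 16 i)%:R * Y])) (leqnn _) _.
    move=> s2 F2 [K1 K2 K3 K4]; split=> k Hk; last by rewrite K1 ?I2; lia.
    have [->|Hne] := eqVneq k i; last by rewrite K1; [apply: I1; lia|apply/eqP].
    by split=> // Hr; apply: K4; lia.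
  (* An entry that lags behind the counter [r] has already passed the test and is final. *)
  apply: (@ends_for _ _ _ _ _ (U + 1) _ (fun r s' => [/\ (forall k, k <> i ->
      iarr s' 16 k = iarr s1 16 k), (0 < iarr s' 16 i)%N ->
      (iarr s' 16 i).-1%:R * Y < X i, (iarr s' 16 i <= r)%N &
      (iarr s' 16 i < r)%N -> X i <= (iarr s' 16 i)%:R * Y])) => //.
  - by move=> s' F; rewrite /= F.1 // F1.1 // HU.
  - by rewrite !I2.
  move=> r s2 Hr F2 E2 [J1 J2 J3 J4]; apply: ends_straight => //.
  have E17 : iarr s2 17 0 = i by rewrite F2.1.
  have ER a b : (a \notin [:: 3; 5; 6; 7])%N -> rarr s2 a b = rarr s a b.
    by move=> Ha; rewrite F2.2 // F1.2.
  have E6 : iarr s2 6 0 = iarr s 6 0 by rewrite F2.1 // F1.1.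
  rewrite /= E17 !ER // E6 -/(X i) -/Y; case: ifPn => Ht.
    by split=> //; lia.
  rewrite -ltNge in Ht; split; rewrite /= /upd /= ?eqxx ?addn1 //.
  - by move=> k Hk; rewrite (introF eqP Hk); apply: J1.
  - rewrite ltnS => H; have := J4 H; lra.
by rewrite /=; nia.
Qed.

End Phases.

(** * Filling and tracing the table *)

Definition index4 (M g k b r : nat) : nat := (((g * M + k) * M + b) * M + r)%N.

Lemma digit_inj M x y x' y' : (y < M)%N -> (y' < M)%N ->
  (x * M + y = x' * M + y')%N -> x = x' /\ y = y'.
Proof.
move=> Hy Hy' E; have M0 : (0 < M)%N by lia.
have Ex : x = x'.
  by move: (congr1 (divn^~ M) E); rewrite !divnMDl // !divn_small // !addn0.
by split=> //; move: E; rewrite Ex => /addnI.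
Qed.

Lemma index4_inj M g k b r g' k' b' r' :
  (k < M)%N -> (b < M)%N -> (r < M)%N -> (k' < M)%N -> (b' < M)%N -> (r' < M)%N ->
  index4 M g k b r = index4 M g' k' b' r' ->
  [/\ g = g', k = k', b = b' & r = r'].
Proof.
rewrite /index4 => Hk Hb Hr Hk' Hb' Hr' /(digit_inj Hr Hr')[+ ->].
by move=> /(digit_inj Hb Hb')[+ ->]; move=> /(digit_inj Hk Hk')[-> ->].
Qed.

Section Table.
Variable R : realType.
Implicit Types s : state R.

Definition index4E g k b r := ((g *! IV 19 +! k) *! IV 19 +! b) *! IV 19 +! r.

Definition here := index4E (IV 20) (IV 21) (IV 22) (IV 23).
Definition leaf_here := index4E (IV 20) (IV 21 -! #1) (IV 22 -! #1) (IV 23).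
Definition split_here := index4E (IV 20 -! #1) (IV 21) (IV 22 +! IV 22)
  (IV 23 -! IGet 16 (IV 21)).

Definition write_cell c v := Seq (ISet 24 here #c) (RSet 5 here v).

Definition load_leaf :=
  If (TILe #1 (IV 22))
     (Seq (set_var 25 (IGet 24 leaf_here)) (RSet 6 #0 (RGet 5 leaf_here)))
     (Seq (set_var 25 #0) (RSet 6 #0 (RCst 0))).

Definition no_split := Seq (set_var 26 #0) (RSet 7 #0 (RCst 0)).

Definition load_split :=
  If (TILe #1 (IV 20))
     (If (TILe (IGet 16 (IV 21)) (IV 23))
         (Seq (set_var 26 (IGet 24 split_here))
              (RSet 7 #0 (RAdd (RGet 5 split_here)
                 (RMul (RGet 4 (IV 21))
                       (RSub (RGet 3 (IV 6 -! IV 20 +! #1))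
                             (RGet 3 (IV 6 -! IV 20)))))))
         no_split)
     no_split.

Definition store_pick :=
  If (TILe (IV 25) #0)
     (If (TILe (IV 26) #0) (write_cell 0 (RCst 0)) (write_cell 2 (RGet 7 #0)))
     (If (TILe (IV 26) #0) (write_cell 1 (RGet 6 #0))
         (If (TRLe (RGet 6 #0) (RGet 7 #0))
             (write_cell 1 (RGet 6 #0)) (write_cell 2 (RGet 7 #0)))).

Definition fill_cell :=
  If (TILe (IV 21) #0)
     (Seq (ISet 24 here (#1 -! IV 22)) (RSet 5 here (RCst 0)))
     (Seq load_leaf (Seq load_split store_pick)).

Definition fill_table :=
  For 20 (IV 6 +! #1)
    (For 21 (IV 0 +! #1)
       (For 22 (IV 0 +! #1)
          (For 23 (IV 10 +! #1) fill_cell))).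

Variables (n D U M : nat) (rk : nat -> nat) (S C : nat -> R).
Hypothesis M_gt : (D + (n + n) + U < M)%N.

Definition consts s :=
  [/\ [/\ iarr s 0 0 = n, iarr s 6 0 = D, iarr s 10 0 = U & iarr s 19 0 = M],
      forall k, iarr s 16 k = rk k, forall k, rarr s 4 k = S k
    & forall d, rarr s 3 d = C d].

Lemma consts_frame p s s' : frame p s s' ->
  all (fun a => a \notin iwrites p) [:: 0; 6; 10; 16; 19]%N ->
  all (fun a => a \notin rwrites p) [:: 3; 4]%N -> consts s -> consts s'.
Proof.
move=> [FI FR] /= /and5P[H0 H6 H10 H16 /andP[H19 _]] /and3P[H3 H4 _].
move=> [[E0 E6 E10 E19] E16 E4 E3].
by split=> [|k|k|k]; [split|..]; rewrite ?FI ?FR.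
Qed.

Definition level_cost g := C (D - g + 1)%N - C (D - g)%N.
Local Notation DP := (dp rk S level_cost).
Local Notation idx := (index4 M).

(** Entries with [b > n] are never written: by [dp_big] the initial zeros are already their correct
    contents, so they count as done from the start. The range up to [n + n] is what splits look
    up. *)
Definition table (done : nat -> nat -> nat -> nat -> bool) s :=
  forall g k b r, (g <= D)%N -> (k <= n)%N -> (b <= n + n)%N -> (r <= U)%N ->
  done g k b r || (n < b)%N ->
  iarr s 24 (idx g k b r) = (DP g k b r).1 /\
  rarr s 5 (idx g k b r) = (DP g k b r).2.

Lemma table_mono (d1 d2 : nat -> nat -> nat -> nat -> bool) s :
  (forall g k b r, (g <= D)%N -> (k <= n)%N -> (b <= n)%N -> (r <= U)%N ->
     d2 g k b r -> d1 g k b r) ->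
  table d1 s -> table d2 s.
Proof.
move=> H T g k b r gD kn bn rU Hd; apply: T => //.
by case: (leqP b n) Hd => Hb; rewrite ?orbT // !orbF => /H; apply.
Qed.

Definition at_cell g k b r s :=
  [/\ iarr s 20 0 = g, iarr s 21 0 = k, iarr s 22 0 = b & iarr s 23 0 = r].

Lemma at_cell_frame p g k b r s s' : frame p s s' ->
  all (fun a => a \notin iwrites p) [:: 20; 21; 22; 23]%N ->
  at_cell g k b r s -> at_cell g k b r s'.
Proof.
by move=> [FI _] /= /and5P[H0 H1 H2 H3 _] [E0 E1 E2 E3]; split; rewrite FI.
Qed.

Lemma table_upd done s s' g k b r :
  (g <= D)%N -> (k <= n)%N -> (b <= n)%N -> (r <= U)%N -> table done s ->
  (forall i, iarr s' 24 i = if i == idx g k b r then (DP g k b r).1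
                            else iarr s 24 i) ->
  (forall i, rarr s' 5 i = if i == idx g k b r then (DP g k b r).2
                           else rarr s 5 i) ->
  table (fun g' k' b' r' => done g' k' b' r' ||
    [&& g' == g, k' == k, b' == b & r' == r]) s'.
Proof.
move=> gD kn bn rU T HI HR g' k' b' r' gD' kn' bn' rU' Hd.
rewrite HI HR; case: eqP => [/index4_inj|Hne].
  by case=> [|||||| -> -> -> ->] //; lia.
apply: T => //; move: Hd; rewrite orbAC => /orP[//|].
case/and4P=> /eqP E1 /eqP E2 /eqP E3 /eqP E4.
by case: Hne; rewrite E1 E2 E3 E4.
Qed.

(** Both subcells, at [(g, k - 1)] and [(g - 1, k)], precede [(g, k)] lexicographically whatever
    their [b] and [r], so the two inner loops of [fill_table] may run in any order. *)
Lemma fill_cell_ok (done : nat -> nat -> nat -> nat -> bool) s g k b r :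
  consts s -> at_cell g k b r s ->
  (g <= D)%N -> (k <= n)%N -> (b <= n)%N -> (r <= U)%N ->
  (forall g' k' b' r', (g' < g)%N || (g' == g) && (k' < k)%N -> done g' k' b' r') ->
  table done s ->
  ends fill_cell s (table (fun g' k' b' r' => done g' k' b' r' ||
    [&& g' == g, k' == k, b' == b & r' == r])) 1000.
Proof.
move=> cs at_s gD kn bn rU Hd Ts.
apply: (@ends_le _ _ _ _ (tcost (TILe (IV 21) #0) + 900)) => //.
apply: ends_if => [Hk|Hk].
  apply: (@ends_le _ _ _ _ (mcost (Seq (ISet 24 here (#1 -! IV 22))
    (RSet 5 here (RCst 0))))) => //.
  case: cs at_s => -[E0 E6 E10 E19] _ _ _ [E20 E21 E22 E23].
  have k0 : k = 0%N by move: Hk; rewrite /= E21; lia.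
  apply: ends_straight => //; apply: (table_upd gD kn bn rU Ts) => i;
    by rewrite /= /upd /= E20 E21 E22 E23 E19 k0 dp0.
have k0 : (0 < k)%N by case: at_s => _ E21 _ _; move: Hk; rewrite /= E21; lia.
pose l := dp_leaf rk S level_cost g k b r; pose x := dp_split rk S level_cost g k b r.
apply: (@ends_le _ _ _ _ (mcost load_leaf + (mcost load_split + mcost store_pick)))
  => //.
apply: (@ends_seq _ _ _ _ (fun s1 => iarr s1 25 0 = l.1 /\ rarr s1 6 0 = l.2)).
  case: (cs) (at_s) => -[E0 E6 E10 E19] _ _ _ [E20 E21 E22 E23].
  apply: ends_straight => //; rewrite /load_leaf /= E22 /l /dp_leaf.
  case: ifP => Hb //=; rewrite /upd /= E19 E20 E21 E22 E23.
  by apply: Ts; rewrite ?Hd //; lia.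
move=> s1 F1 [L1 L2].
have cs1 := consts_frame F1 isT isT cs; have at1 := at_cell_frame F1 isT at_s.
apply: (@ends_seq _ _ _ _ (fun s2 => iarr s2 26 0 = x.1 /\ rarr s2 7 0 = x.2)).
  case: (cs1) (at1) => -[E0 E6 E10 E19] E16 E4 E3 [E20 E21 E22 E23].
  apply: ends_straight => //; rewrite /load_split /= E20 /x /dp_split.
  case: ifP => Hg //=; rewrite E21 E23 E16; case: ifP => Hr //=.
  rewrite /upd /= E19 E20 E21 E22 E23 E16 E4 E6 !E3 F1.1 // F1.2 //.
  by have [||||| -> ->] := Ts (g - 1)%N k (b + b)%N (r - rk k)%N; rewrite ?Hd //; lia.
move=> s2 F2 [X1 X2].
have cs2 := consts_frame F2 isT isT cs1; have at2 := at_cell_frame F2 isT at1.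
case: (cs2) (at2) => -[E0 E6 E10 E19] E16 E4 E3 [E20 E21 E22 E23].
have L1' : iarr s2 25 0 = l.1 by rewrite F2.1.
have L2' : rarr s2 6 0 = l.2 by rewrite F2.2.
have Edp : DP g k b r = pick2 l x by rewrite -(prednK k0) dpS prednK.
have T2 : table done s2.
  by move=> g' k' b' r' *; rewrite F2.1 // F1.1 // F2.2 // F1.2 //; apply: Ts.
apply: ends_straight => //; apply: (table_upd gD kn bn rU T2) => i;
  rewrite /= L1' X1 L2' X2 Edp /pick2;
  by case: (l.1 <= 0)%N (x.1 <= 0)%N (l.2 <= x.2) => [] [] [];
    rewrite /= /upd /= E19 E20 E21 E22 E23 ?L2' ?X2.
Qed.

Lemma fill_table_ok s : consts s ->
  (forall i, iarr s 24 i = 0%N) -> (forall i, rarr s 5 i = 0) ->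
  ends fill_table s (table (fun _ _ _ _ => true))
    (2000 * (D.+2 * (n.+2 * (n.+2 * U.+2)))).
Proof.
move=> cs H24 H5; apply: ends_le; last first.
  apply: (@ends_imp _ _ _ (table (fun g' _ _ _ => g' < D + 1)%N)) (leqnn _) _.
    by move=> s' _; apply: table_mono => *; lia.
  apply: (@ends_for _ _ _ _ _ (D + 1) _
    (fun g => table (fun g' _ _ _ => g' < g)%N)) => //.
  - move=> s' F; have [[_ E6 _ _] _ _ _] := consts_frame F isT isT cs.
    by rewrite /= E6.
  - move=> g k b r _ kn _ _ /= Hb; rewrite H24 H5 dp_big //; lia.
  move=> g s1 Hg F1 E1 T1; have cs1 := consts_frame F1 isT isT cs.
  apply: (@ends_imp _ _ _ (table (fun g' k' _ _ =>
    (g' < g) || (g' == g) && (k' < n + 1))%N)) (leqnn _) _.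
    by move=> s' _; apply: table_mono => *; lia.
  apply: (@ends_for _ _ _ _ _ (n + 1) _ (fun k => table (fun g' k' _ _ =>
    (g' < g) || (g' == g) && (k' < k))%N)) => //.
  - move=> s' F; have [[E0 _ _ _] _ _ _] := consts_frame F isT isT cs1.
    by rewrite /= E0.
  - by move: T1; apply: table_mono => *; lia.
  move=> k s2 Hk F2 E2 T2; have cs2 := consts_frame F2 isT isT cs1.
  apply: (@ends_imp _ _ _ (table (fun g' k' b' _ =>
    (g' < g) || (g' == g) && ((k' < k) || (k' == k) && (b' < n + 1)))%N)) (leqnn _) _.
    by move=> s' _; apply: table_mono => *; lia.
  apply: (@ends_for _ _ _ _ _ (n + 1) _ (fun b => table (fun g' k' b' _ =>
    (g' < g) || (g' == g) && ((k' < k) || (k' == k) && (b' < b)))%N)) => //.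
  - move=> s' F; have [[E0 _ _ _] _ _ _] := consts_frame F isT isT cs2.
    by rewrite /= E0.
  - by move: T2; apply: table_mono => *; lia.
  move=> b s3 Hb F3 E3 T3; have cs3 := consts_frame F3 isT isT cs2.
  apply: (@ends_imp _ _ _ (table (fun g' k' b' r' => (g' < g) || (g' == g) &&
    ((k' < k) || (k' == k) && ((b' < b) || (b' == b) && (r' < U + 1))))%N)) (leqnn _) _.
    by move=> s' _; apply: table_mono => *; lia.
  apply: (@ends_for _ _ _ _ _ (U + 1) _ (fun r => table (fun g' k' b' r' =>
    (g' < g) || (g' == g) &&
    ((k' < k) || (k' == k) && ((b' < b) || (b' == b) && (r' < r))))%N)) => //.
  - move=> s' F; have [[_ _ E10 _] _ _ _] := consts_frame F isT isT cs3.
    by rewrite /= E10.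
  - by move: T3; apply: table_mono => *; lia.
  move=> r s4 Hr F4 E4 T4; have cs4 := consts_frame F4 isT isT cs3.
  have at4 : at_cell g k b r s4.
    by split=> //; rewrite F4.1 // ?F3.1 // ?F2.1.
  have [gD kD bD rD] : [/\ (g <= D)%N, (k <= n)%N, (b <= n)%N & (r <= U)%N].
    by split; lia.
  have K := fill_cell_ok cs4 at4 gD kD bD rD _ T4.
  apply: (ends_imp _ (leqnn 1000) (K _)) => [s' _|*]; last by lia.
  by apply: table_mono => *; lia.
by rewrite /=; nia.
Qed.

Definition trace_body :=
  If (TILe (IGet 24 (index4E (IV 27) (IV 28) (IV 29) (IV 30))) #1)
     (Seq (ISet 31 (IV 28 -! #1) (IV 6 -! IV 27))
          (Seq (set_var 28 (IV 28 -! #1)) (set_var 29 (IV 29 -! #1))))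
     (Seq (set_var 30 (IV 30 -! IGet 16 (IV 28)))
          (Seq (set_var 27 (IV 27 -! #1)) (set_var 29 (IV 29 +! IV 29)))).

Definition trace_loop := While (TILe #1 (IV 28)) trace_body.

Definition trace :=
  Seq (Seq (set_var 27 (IV 6))
           (Seq (set_var 28 (IV 0)) (Seq (set_var 29 #1) (set_var 30 (IV 10)))))
      trace_loop.

Section Trace.
Variables (F : nat -> R) (Y : R).
Hypothesis Y_ge0 : 0 <= Y.
Hypothesis S_F : forall k, (k <= n)%N -> S k = \sum_(j < k) F j.
Hypothesis rk_Y : forall k, (k <= n)%N -> (rk k <= U)%N ->
  S k * D%:R <= (rk k)%:R * Y.

(** Each step lowers [g + k] by one. A leaf step records its depth before the loop goes on, so the
    induction must also guarantee that the entries from [k] on survive. *)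
Lemma trace_loop_ok s g k b r : consts s -> table (fun _ _ _ _ => true) s ->
  [/\ iarr s 27 0 = g, iarr s 28 0 = k, iarr s 29 0 = b & iarr s 30 0 = r] ->
  (g <= D)%N -> (k <= n)%N -> (r <= U)%N -> (DP g k b r).1 <> 0%N ->
  ends trace_loop s (fun s' =>
    witness D C F Y g k b r (DP g k b r).2 (iarr s' 31) /\
    forall j, (k <= j)%N -> iarr s' 31 j = iarr s 31 j) (100 * (g + k).+1).
Proof.
have [m] := ubnP (g + k); elim: m => // m IH in s g k b r *.
rewrite ltnS => Hm cs Ts [E27 E28 E29 E30] gD kn rU Hf.
case: (cs) => -[E0 E6 E10 E19] E16 E4 E3.
case: k => [|k] in Hm E28 kn Hf *.
  exists s, (tcost (TILe #1 (IV 28))); split; last by rewrite /=; lia.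
    by apply: ExecWhileF; rewrite /= E28.
  split=> //; move: Hf; rewrite dp0 /= => Hb.
  have -> : b = 0%N by lia.
  exact: witness0.
have bn : (b <= n + n)%N.
  have [Hb|Hb] := leqP b k.+1; first by lia.
  by case: Hf; rewrite dp_big.
have Hb : teval s (TILe #1 (IV 28)) by rewrite /= E28.
have [Ech _] := Ts g k.+1 b r gD kn bn rU isT.
have [t1 Ex Ht1] := exec_straight s (isT : straight trace_body).
set s1 := run trace_body s in Ex.
have Fr := exec_frame Ex; have cs1 := consts_frame Fr isT isT cs.
have Ts1 : table (fun _ _ _ _ => true) s1.
  by move=> *; rewrite Fr.1 // Fr.2 //; apply: Ts.
have next g' k' b' r' : (g' + k' < g + k.+1)%N ->
    [/\ iarr s1 27 0 = g', iarr s1 28 0 = k', iarr s1 29 0 = b'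
      & iarr s1 30 0 = r'] ->
    (k' <= k.+1)%N -> (g' <= g)%N -> (r' <= r)%N -> (DP g' k' b' r').1 <> 0%N ->
    (forall e, witness D C F Y g' k' b' r' (DP g' k' b' r').2 e ->
       (forall j, (k' <= j)%N -> e j = iarr s1 31 j) ->
       witness D C F Y g k.+1 b r (DP g k.+1 b r).2 e) ->
    (forall j, (k.+1 <= j)%N -> iarr s1 31 j = iarr s 31 j) ->
    ends trace_loop s (fun s' =>
      witness D C F Y g k.+1 b r (DP g k.+1 b r).2 (iarr s' 31) /\
      forall j, (k.+1 <= j)%N -> iarr s' 31 j = iarr s 31 j) (100 * (g + k.+1).+1).
  move=> lt at1 k'k g'g r'r Hf' Hw Hj.
  have [||||s2 [t2 [Ex2 [W2 J2] Ht2]]] := IH s1 g' k' b' r' _ cs1 Ts1 at1 _ _ _ Hf';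
    try lia.
  exists s2, (tcost (TILe #1 (IV 28)) + t1 + t2)%N; split.
  - exact: ExecWhileT Hb Ex Ex2.
  - split; first exact: Hw.
    by move=> j Hjk; rewrite J2 ?Hj //; lia.
  - move: Ht1 Ht2; rewrite /=; lia.
have chE : iarr s 24 (ieval s (index4E (IV 27) (IV 28) (IV 29) (IV 30)))
    = (DP g k.+1 b r).1 by rewrite /= E27 E28 E29 E30 E19.
case: (dp_stepP Hf) => [D1 b0 Hn D2|D1 g0 Hr Hn D2].
  have Es1 : s1 = run (Seq (ISet 31 (IV 28 -! #1) (IV 6 -! IV 27))
      (Seq (set_var 28 (IV 28 -! #1)) (set_var 29 (IV 29 -! #1)))) s.
    by rewrite /s1 /trace_body [LHS]/= -/(ieval _ _) chE D1.
  apply: (next g k b.-1 r) => //; rewrite ?Es1 /=; try lia.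
  - by split; rewrite /upd /= ?E28 ?E29 ?subn1.
  - move=> e We ej; rewrite D2 -(prednK b0); apply: witness_leaf => //.
    by rewrite ej // /upd /= E28 subn1 eqxx E6 E27.
  - by move=> j Hj; rewrite /upd /= E28 subn1 /=; case: eqP => //; lia.
have Es1 : s1 = run (Seq (set_var 30 (IV 30 -! IGet 16 (IV 28)))
    (Seq (set_var 27 (IV 27 -! #1)) (set_var 29 (IV 29 +! IV 29)))) s.
  by rewrite /s1 /trace_body [LHS]/= -/(ieval _ _) chE D1.
apply: (next g.-1 k.+1 (b + b)%N (r - rk k.+1)%N) => //; rewrite ?Es1 /=; try lia.
  by split; rewrite /upd /= ?E27 ?E28 ?E29 ?E30 ?E16 ?subn1.
move=> e We _; rewrite D2 /level_cost.
case: g g0 We gD {Hm E27 Ech chE next D1 D2 Hf Hn} => //.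
move=> g _ We gD; rewrite /= in We *.
have -> : (D - g.+1 + 1 = D - g)%N by lia.
have Hle : (rk k.+1 <= U)%N by lia.
  exact: witness_split gD (S_F kn) We Hr (rk_Y kn Hle).
by [].
Qed.

Lemma trace_ok s : consts s -> table (fun _ _ _ _ => true) s ->
  (DP D n 1 U).1 <> 0%N ->
  ends trace s
    (fun s' => witness D C F Y D n 1 U (DP D n 1 U).2 (iarr s' 31))
    (200 * (D + n).+1).
Proof.
move=> cs Ts Hf; case: (cs) => -[E0 E6 E10 E19] E16 E4 E3.
apply: ends_le; last first.
  apply: (@ends_seq _ _ _ _ (fun s1 => [/\ iarr s1 27 0 = D, iarr s1 28 0 = n,
      iarr s1 29 0 = 1%N & iarr s1 30 0 = U])).
    by apply: ends_straight => //=.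
  move=> s1 F1 at1; have cs1 := consts_frame F1 isT isT cs.
  have Ts1 : table (fun _ _ _ _ => true) s1.
    by move=> *; rewrite F1.1 // F1.2 //; apply: Ts.
  apply: ends_imp (leqnn _) (trace_loop_ok cs1 Ts1 at1 _ _ _ Hf) => //.
  by move=> s' _ [].
by rewrite /=; lia.
Qed.
End Trace.
End Table.

(** * Writing the tree in preorder *)

Section Emit.
Variables (R : realType) (n : nat).
Implicit Types (s : state R) (T : tree n).

Definition emit_test := TILe (IGet 31 (IV 34 -! #1)) (IGet 33 (IV 32 -! #1)).

Definition emit_leaf :=
  Seq (ISet 2 (IV 35) (IGet 14 (IV 34 -! #1) +! #1))
      (Seq (set_var 34 (IV 34 -! #1)) (set_var 32 (IV 32 -! #1))).

Definition emit_node :=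
  Seq (ISet 2 (IV 35) #0)
      (Seq (ISet 33 (IV 32) (IGet 33 (IV 32 -! #1) +! #1))
           (Seq (ISet 33 (IV 32 -! #1) (IGet 33 (IV 32 -! #1) +! #1)) (incr 32))).

Definition emit_body := Seq (If emit_test emit_leaf emit_node) (incr 35).

Lemma run_emit_body s : run emit_body s =
  run (incr 35) (if teval s emit_test then run emit_leaf s else run emit_node s).
Proof. by []. Qed.

Definition emit_loop := While (TILe #1 (IV 32)) emit_body.

Definition emit := Seq (Seq (set_var 32 #1) (set_var 34 (IV 0))) emit_loop.

Lemma leaf_depths_head c T :
  exists2 p, exists q, leaf_depths c T = p :: q & (c <= p.2)%N.
Proof.
elim: T c => [x|l IHl r IHr] c; first by exists (x, c) => //; exists [::].
have [p [q Eq] Hp] := IHl c.+1; exists p; last exact: ltnW.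
by exists (q ++ leaf_depths c.+1 r); rewrite /= Eq.
Qed.

Lemma rev_iotaS k : rev (iota 0 k.+1) = k :: rev (iota 0 k).
Proof. by rewrite -addn1 iotaD rev_cat. Qed.

Definition pair_val (p : 'I_n * nat) : nat * nat := (val p.1, p.2).

(** The stack holds the root depths of the pending subtrees [ts], the next one on top. All leaves
    below an internal node are deeper than the node, so comparing the next character's depth with
    the top tells whether the next subtree is a leaf. *)
Lemma emit_loop_ok s (st : seq nat) (ts : seq (tree n)) k o :
  size ts = size st ->
  [/\ iarr s 32 0 = size st, iarr s 34 0 = k & iarr s 35 0 = o] ->
  (forall i, (i < size st)%N -> iarr s 33 (size st - i.+1) = nth 0%N st i) ->
  map pair_val (forest_depths st ts)
    = [seq (iarr s 14 i, iarr s 31 i) | i <- rev (iota 0 k)] ->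
  let code := flatten (map (@tree_code n) ts) in
  ends emit_loop s (fun s' =>
    (forall i, (i < size code)%N -> iarr s' 2 (o + i) = nth 0%N code i) /\
    (forall i, (i < o)%N -> iarr s' 2 i = iarr s 2 i))
    (200 * (size code).+1).
Proof.
move=> sz at_s Hst Hfd code; rewrite {}/code.
have [m] := ubnP (size (flatten (map (@tree_code n) ts))).
elim: m => // m IH in s st ts k o sz at_s Hst Hfd *; rewrite ltnS => Hm.
case: at_s => E32 E34 E35.
case: st ts => [|c st] [|t ts] // in sz Hst Hfd Hm E32 *.
  exists s, (tcost (TILe #1 (IV 32))); split => //.
  by apply: ExecWhileF; rewrite /= E32.
have Hb : teval s (TILe #1 (IV 32)) by rewrite /= E32.
have Etop : iarr s 33 (iarr s 32 0 - 1) = c by rewrite E32 (Hst 0%N).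
have [t1 Ex Ht1] := exec_straight s (isT : straight emit_body).
set s1 := run emit_body s in Ex.
have Fr := exec_frame Ex.
have next x st' ts' k' : tree_code t ++ flatten (map (@tree_code n) ts)
      = x :: flatten (map (@tree_code n) ts') ->
    size ts' = size st' ->
    [/\ iarr s1 32 0 = size st', iarr s1 34 0 = k' & iarr s1 35 0 = o.+1] ->
    (forall i, (i < size st')%N -> iarr s1 33 (size st' - i.+1) = nth 0%N st' i) ->
    map pair_val (forest_depths st' ts')
      = [seq (iarr s 14 i, iarr s 31 i) | i <- rev (iota 0 k')] ->
    iarr s1 2 o = x -> (forall i, (i < o)%N -> iarr s1 2 i = iarr s 2 i) ->
    ends emit_loop s (fun s' =>
      (forall i, (i < size (flatten (map (@tree_code n) (t :: ts))))%N ->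
         iarr s' 2 (o + i) = nth 0%N (flatten (map (@tree_code n) (t :: ts))) i) /\
      (forall i, (i < o)%N -> iarr s' 2 i = iarr s 2 i))
      (200 * (size (flatten (map (@tree_code n) (t :: ts)))).+1).
  move=> Ec sz' at1 Hst' Hfd' Ho Hlt; rewrite /= in Hm *; rewrite Ec /= in Hm *.
  have [|s2 [t2 [Ex2 [O2 L2] Ht2]]] := IH s1 st' ts' k' o.+1 sz' at1 Hst' _ Hm.
    rewrite Hfd'; apply: eq_map => i; by rewrite !Fr.1.
  exists s2, (tcost (TILe #1 (IV 32)) + t1 + t2)%N; split.
  - exact: ExecWhileT Hb Ex Ex2.
  - split=> [[|i] Hi|i Hi].
    + by rewrite addn0 L2.
    + by rewrite addnS -addSn O2.
    + by rewrite L2 ?Hlt // ltnW.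
  - move: Ht1 Ht2; rewrite /=; lia.
case: t => [x|l r] in sz Hfd Hm next *.
  case: k => [|k] in Hfd E34 *; first by [].
  move: Hfd; rewrite rev_iotaS /= => -[Ex1 Ec Hrest].
  have Ht : teval s emit_test by rewrite /= -/(iarr s 32 0 - 1)%N Etop E34 subn1 -Ec.
  have Es1 : s1 = run (incr 35) (run emit_leaf s) by rewrite /s1 run_emit_body Ht.
  have E32' : iarr s1 32 0 = size st by rewrite Es1 /= /upd /= E32 subn1.
  apply: (next x.+1 st ts k) => //.
  - by case: sz.
  - by split=> //; rewrite Es1 /= /upd /= ?E34 ?E35 ?subn1 ?addn1.
  - move=> i Hi; rewrite Es1 /= /upd /=; have := Hst i.+1 Hi.
    by rewrite /= subSS.
  - by rewrite Es1 /= /upd /= E35 eqxx E34 subn1 -Ex1 addn1.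
  - by move=> i Hi; rewrite Es1 /= /upd /= E35; case: eqP => //; lia.
have [p [q Ep] Hp] := leaf_depths_head c.+1 l.
case: k => [|k] in Hfd E34 *; first by move: Hfd; rewrite /= Ep.
have Ed : (c < iarr s 31 k)%N.
  by move: (Hfd); rewrite rev_iotaS /= Ep /= => -[_ <-].
have Ht : teval s emit_test = false.
  by rewrite /= -/(iarr s 32 0 - 1)%N Etop E34 subn1 leqNgt Ed.
have Es1 : s1 = run (incr 35) (run emit_node s) by rewrite /s1 run_emit_body Ht.
apply: (next 0%N [:: c.+1, c.+1 & st] [:: l, r & ts] k.+1) => //.
- by rewrite /= catA.
- by case: sz => sz; rewrite /= sz.
- by split=> //; rewrite Es1 /= /upd /= ?E32 ?E34 ?E35 ?addn1.
- have top : iarr s 33 (size st) = c by rewrite -Etop E32 /= subn1.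
  move=> i Hi; rewrite Es1 /= /upd /= E32 /= subn1 /=.
  have nS : (size st == (size st).+1) = false by lia.
  rewrite nS top addn1.
  case: i => [|[|i]] in Hi *.
  + by rewrite subSS subn0 eqxx; case: eqP => //; lia.
  + by rewrite !subSS subn0 eqxx.
  + have -> : ((size st).+2 - i.+3 = (size st).+1 - i.+2)%N by lia.
    have Hi' : (i.+1 < (size st).+1)%N by move: Hi; rewrite /=; lia.
    have := Hst i.+1 Hi'; rewrite /= => <-.
    case: eqP => [E|_]; first by move: E Hi'; lia.
    case: eqP => [E|_]; first by move: E Hi'; lia.
    by [].
- by rewrite -Hfd /= catA.
- by rewrite Es1 /= /upd /= E35 eqxx.
- by move=> i Hi; rewrite Es1 /= /upd /= E35; case: eqP => //; lia.
Qed.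

Lemma emit_ok s T : iarr s 33 0 = 0%N -> iarr s 35 0 = 0%N ->
  map pair_val (leaf_depths 0 T)
    = [seq (iarr s 14 i, iarr s 31 i) | i <- rev (iota 0 (iarr s 0 0))] ->
  ends emit s (fun s' => outputs s' T) (300 * (size (tree_code T)).+1).
Proof.
move=> H33 H35 HT; apply: ends_le; last first.
  apply: (@ends_seq _ _ _ _ (fun s1 => [/\ iarr s1 32 0 = 1%N,
    iarr s1 34 0 = iarr s 0 0 & iarr s1 35 0 = 0%N])).
    by apply: ends_straight.
  move=> s1 F1 at1.
  have := @emit_loop_ok s1 [:: 0%N] [:: T] (iarr s 0 0) 0 erefl at1.
  rewrite /= !cats0 => H; apply: ends_imp (leqnn _) (H _ _).
  - by move=> s' _ [H' _] i /H'.
  - by move=> [|//] _; rewrite F1.1 // subnn.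
  - by rewrite HT; apply: eq_map => i; rewrite !F1.1.
by rewrite /=; lia.
Qed.

End Emit.

(** * Approximation guarantees *)

Lemma round_total (R : realType) D U (ep L : R) (x : 'I_D -> R) (rho : 'I_D -> nat) :
  0 < ep -> U = (Num.truncn (D%:R / ep) + D)%N ->
  (forall h, 0 <= x h) -> \sum_h x h <= L ->
  (forall h, rounded (x h * D%:R) (ep * L) U (rho h)) ->
  (\sum_h rho h <= U)%N.
Proof.
move=> e0 -> x0 HL Hr.
have L0 : 0 <= L by apply: le_trans HL; apply: sumr_ge0.
(* A zero length leaves no unit to divide by, but then every [x h] vanishes and rounds to 0. *)
have [L1|L1] := eqVneq L 0.
  have rho0 h : rho h = 0%N.
    have xh : x h = 0.
      apply/eqP; rewrite eq_le x0 andbT -L1; apply: le_trans HL.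
      by rewrite (bigD1 h) //= lerDl sumr_ge0.
    have [H _] := Hr h; move: H; rewrite xh L1 mul0r mulr0 mulr0 ltxx.
    by case: (rho h) => // r /(_ isT).
  by rewrite big1.
have Lp : 0 < L by rewrite lt_def L1.
have y0 : 0 < ep * L by rewrite mulr_gt0.
(* Rounding up adds at most one unit per level, hence at most [D] units in all. *)
have step h : (rho h)%:R * (ep * L) <= x h * D%:R + ep * L.
  have [H _] := Hr h; case: (rho h) H => [_|r /(_ isT) /ltW /=].
    by rewrite mul0r addr_ge0 ?mulr_ge0 // ltW.
  by rewrite -natr1 mulrDl mul1r lerD2r.
have tot : (\sum_h rho h)%:R * (ep * L) <= L * D%:R + D%:R * (ep * L).
  rewrite natr_sum mulr_suml; apply: le_trans (ler_sum _ (fun h _ => step h)) _.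
  rewrite big_split /= -mulr_suml sumr_const card_ord -[ep * L *+ D]mulr_natl lerD2r.
  by rewrite ler_wpM2r.
have tot' : (\sum_h rho h)%:R * ep <= D%:R + D%:R * ep.
  rewrite -(ler_pM2r Lp); move: tot; congr (_ <= _); ring.
have [H|HD] := leqP (\sum_h rho h)%N D; first exact: leq_trans H (leq_addl _ _).
rewrite addnC -leq_subLR truncn_ge_nat; last by rewrite divr_ge0 // ltW.
by rewrite ler_pdivlMr // natrB 1?ltnW // mulrBl; lra.
Qed.

Lemma size_tree_code n (T : tree n) :
  (size (tree_code T)).+1 = (size (leaves T)).*2.
Proof.
by elim: T => //= l IHl r IHr; rewrite !size_cat doubleD -IHl -IHr; lia.
Qed.

Section Instance.
Variables (R : realType) (x : instance R).
Hypothesis adm : admissible x.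
Local Notation n := (nchars x).
Local Notation bs := (bscheme x).

Lemma adm_bs : forall j, (j < size bs)%N -> (0 < width bs j)%N /\ 0 <= acost bs j.
Proof. by case: adm. Qed.

Lemma decode_timeE T : prefix_tree T ->
  decode_time bs (freq x) T = \sum_c (freq x c)%:R * lcost bs (depth T c).
Proof.
move=> pT; apply: eq_bigr => c _; congr (_ * _); rewrite /decode_char.
have dW : (depth T c <= \sum_(j < size bs) width bs j)%N.
  by case: adm => _ _ _ H _; apply: H.
by rewrite (nblocksE adm_bs dW) lcostE.
Qed.

Lemma lenE T : (len (freq x) T)%:R = \sum_c (freq x c)%:R * (depth T c)%:R :> R.
Proof. by rewrite /len natr_sum; apply: eq_bigr => c _; rewrite natrM. Qed.

Variables (lam J D U : nat).
Hypothesis n_lam : (n <= 2 ^ lam)%N.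
Hypothesis J0 : (0 < J)%N.
Hypothesis J_delta : 2 <= J%:R * delta x.
Hypothesis D_run : (J + lam + 2 <= lrun bs D)%N.
Hypothesis U_def : U = (Num.truncn (D%:R / eps x) + D)%N.

Let L' := (1 + delta x) * codelen x.

Variables (rk : nat -> nat) (S Cs F : nat -> R) (sg : 'I_n -> 'I_n).
Hypothesis S_F : forall k, (k <= n)%N -> S k = \sum_(j < k) F j.
Hypothesis Cs_cost : forall d, (d <= D)%N -> Cs d = lcost bs d.
Hypothesis rk_S : forall k, (k <= n)%N ->
  rounded (S k * D%:R) (eps x * L') U (rk k).
Hypothesis sg_inj : injective sg.
Hypothesis F_sg : forall i : 'I_n, F i = (freq x (sg i))%:R.
Hypothesis F_mono : forall i j, (i <= j < n)%N -> F i <= F j.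

Local Notation DP := (dp rk S (level_cost D Cs)).

Lemma lrun_le d : (lrun bs d <= d)%N.
Proof. by elim: d => //= d IH; case: ifP. Qed.

Lemma D_ge : (J + lam + 2 <= D)%N.
Proof. exact: leq_trans D_run (lrun_le D). Qed.

Lemma S_ge0 k : (k <= n)%N -> 0 <= S k.
Proof.
move=> kn; rewrite S_F //; apply: sumr_ge0 => j _.
by rewrite (F_sg (Ordinal (leq_trans (ltn_ord j) kn))).
Qed.

(** Completeness is applied to the capped depths of an arbitrary feasible tree. The cap's loss in
    length is already contained in [L'], from which the unit is formed, so the budget [U]
    suffices. *)
Lemma dp_approx T : feasible x T ->
  (DP D n 1 U).1 <> 0%N /\
  (DP D n 1 U).2 <= (1 + delta x) * decode_time bs (freq x) T.
Proof.
case=> pT lenT; have [e0 d0 _ _ _] := adm; have Cm := lcost_mono adm_bs.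
have C0 : 0 <= lcost bs 0 by [].
have Cd d : (D - (J + lam + 2) <= d < D)%N -> lcost bs d.+1 <= 2 * lcost bs d.
  by move=> Hd; apply: (@lrun_good _ bs D); have := D_run; lia.
have [d [dD Kd lend costd]] := depth_cap (freq x) pT n_lam J0 D_ge C0 Cm Cd
  (ltW d0) J_delta.
pose A h := #|[set c | h < d c]%N|.
have An h : (A h <= n)%N by rewrite -[X in (_ <= X)%N]card_ord max_card.
have cake (C : nat -> R) : {homo C : x y / (x <= y)%N >-> x <= y} ->
    \sum_(h < D) S (A h) * (C h.+1 - C h) <= \sum_c (freq x c)%:R * (C (d c) - C 0).
  move=> Chom; have := @layer_cake R n F F_mono (fun c => (freq x c)%:R) sg sg_inj F_sg
    C D d Chom dD.
  apply: le_trans; rewrite le_eqVlt; apply/orP; left; apply/eqP.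
  by apply: eq_bigr => h _; rewrite S_F.
have E_C g : (0 < g <= D)%N ->
    level_cost D Cs g = lcost bs (D - g).+1 - lcost bs (D - g)%N.
  by move=> Hg; rewrite /level_cost addn1 !Cs_cost //; lia.
have budget : (\sum_(h < D) rk (A h) <= U)%N.
  apply: (@round_total R D U (eps x) L' (fun h => S (A h))) => //.
  - by move=> h; apply: S_ge0.
  (* The length is the decode time for the cost function that charges 1 per level. *)
  - have natm : {homo (fun h => h%:R : R) : x y / (x <= y)%N >-> x <= y}.
      by move=> a b; rewrite ler_nat.
    have := cake _ natm; under eq_bigr => h _ do rewrite -natr1 addrC addKr mulr1.
    under [X in _ <= X -> _]eq_bigr => c _ do rewrite subr0.
    move=> H; apply: le_trans H _.
    apply: le_trans lend _; rewrite -lenE /L' ler_wpM2l //.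
    by rewrite addr_ge0 // ltW.
  - by move=> h; apply: rk_S.
have [H1 H2] := dp_complete dD Cm S_ge0 E_C Kd budget; split=> //.
apply: le_trans H2 _; rewrite decode_timeE //; apply: le_trans (cake _ Cm) _.
by under eq_bigr => c _ do rewrite [lcost bs 0]/= subr0.
Qed.

(** Read backwards, from the most to the least frequent character, the depths increase, as the
    canonical code requires. *)
Lemma witness_tree (e : nat -> nat) v :
  witness D Cs F (eps x * L') D n 1 U v e ->
  exists T : tree n,
    [/\ leaf_depths 0 T = [seq (sg i, e i) | i : 'I_n <- rev (enum 'I_n)],
        prefix_tree T,
        (len (freq x) T)%:R <= (1 + eps x) * (1 + delta x) * codelen x
      & decode_time bs (freq x) T = v].
Proof.
case=> Wr Wm Wk Wc Wl; have [e0 d0 _ _ _] := adm.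
set ls := map _ _.
have srt : sorted leq (map snd ls).
  rewrite /ls -map_comp map_rev rev_sorted.
  have -> : map (snd \o (fun i : 'I_n => (sg i, e i))) (enum 'I_n)
      = map e (iota 0 n) by rewrite -val_enum_ord -map_comp.
  apply/(sortedP 0%N) => i; rewrite size_map size_iota => Hi.
  rewrite !(nth_map 0%N) ?size_iota //; last by lia.
  by rewrite !nth_iota ?add0n; [apply: Wm|..]; lia.
have [|||ts] := @forest_exists n D [:: 0%N] ls srt.
- by apply/allP => p /mapP[i _ ->] /=; have := Wr i (ltn_ord i); lia.
- by move=> c p; rewrite mem_seq1 => /eqP ->.
- rewrite big_seq1 subn0 /ls big_map big_rev /= big_enum /=.
  by rewrite -(mul1n (2 ^ D)%N) Wk.
case: ts => [|T []] // _; rewrite /= cats0 => ET.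
have lT : leaves T = map sg (rev (enum 'I_n)).
  by rewrite -(map_leaf_depths 0) ET /ls -map_comp.
have uT : uniq (leaves T).
  by rewrite lT map_inj_uniq // rev_uniq enum_uniq.
have pT : prefix_tree T.
  apply: uniq_perm => //; first exact: enum_uniq.
  move=> c; rewrite mem_enum lT; have [sg' sgK' sgK] := injF_bij sg_inj.
  by rewrite -(sgK c) map_f // mem_rev mem_enum.
have dT i : depth T (sg i) = e i.
  have := leaf_depthsE 0 uT; rewrite ET /ls lT -map_comp => /eq_in_map H.
  by have := H i; rewrite mem_rev mem_enum => /(_ isT) /= [->].
have sumT (h : nat -> R) : \sum_c (freq x c)%:R * h (depth T c)
    = \sum_(j < n) F j * h (e j).
  by rewrite (reindex_inj sg_inj); apply: eq_bigr => i _; rewrite dT F_sg.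
exists T; split=> //.
- have D0 : 0 < D%:R :> R by rewrite ltr0n; have := D_ge; lia.
  rewrite lenE (sumT (fun h => h%:R)) -(ler_pM2r D0).
  move: Wl; rewrite subnn; under eq_bigr => j _ do rewrite subn0.
  move=> Wl; apply: le_trans Wl _; rewrite mulrA.
  have -> : (1 + eps x) * (1 + delta x) * codelen x * D%:R
      = (D%:R + D%:R * eps x) * L' by rewrite /L'; ring.
  have L0 : 0 <= L'.
    have [_ _ _ _ [T0 [_ H]]] := adm; have cl := le_trans (ler0n _ _) H.
    by apply: mulr_ge0 => //; apply: addr_ge0 => //; apply: ltW.
  apply: ler_wpM2r => //; rewrite U_def natrD mulrDl lerD2r -ler_pdivlMr //.
  by rewrite truncn_le divr_ge0 // ltW.
rewrite decode_timeE // sumT -Wc; apply: eq_bigr => j _.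
have /andP[_ eD] := Wr j (ltn_ord j).
by rewrite subnn !Cs_cost // [lcost bs 0]/= subr0.
Qed.

End Instance.

(** * The whole program *)

Definition set_base := set_var 19 (IV 6 +! (IV 0 +! IV 0) +! IV 10 +! #1).

Definition decode_opt :=
  Seq count_groups (Seq log_size (Seq scan_levels (Seq round_budget
  (Seq sort_chars (Seq prefix_sums (Seq round_sums (Seq set_base
  (Seq fill_table (Seq trace emit))))))))).

Section Program.
Variable R : realType.

Lemma frame_seq p q (s1 s2 s3 : state R) :
  frame p s1 s2 -> frame q s2 s3 -> frame (Seq p q) s1 s3.
Proof.
move=> F1 F2; apply: frame_trans.
  by apply: frame_sub F1 => a /= Ha; rewrite mem_cat Ha.
by apply: frame_sub F2 => a /= Ha; rewrite mem_cat Ha orbT.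
Qed.

Variable x : instance R.
Hypothesis adm : admissible x.
Local Notation n := (nchars x).
Local Notation bs := (bscheme x).

Definition groups := (Num.truncn (2 / delta x)).+1.
Definition run_goal := (groups + up_log 2 n + 2)%N.

Definition good_output (s : state R) := exists T : tree n,
  [/\ outputs s T, prefix_tree T,
      (len (freq x) T)%:R <= (1 + eps x) * (1 + delta x) * codelen x
    & forall T0, feasible x T0 -> decode_time bs (freq x) T
        <= (1 + delta x) * decode_time bs (freq x) T0].

Definition work D :=
  (D.+2 * (n.+2 * (n.+2 * (Num.truncn (D%:R / eps x) + D).+2)))%N.

Lemma decode_opt_ok : exists D,
  [/\ (run_goal <= D)%N, (D <= (hierarchies bs).+1 * run_goal)%N
    & ends decode_opt (initial x) good_output (5000 * work D)].
Proof.
have [e0 d0 Hbs _ [T0 HT0]] := adm.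
have [D' HD' leD'] := lrun_ex Hbs (isT : (0 < run_goal)%N).
have exD : exists d, (run_goal <= lrun bs d)%N by exists D'.
(* The least such level is the one at which the scan stops; [D'] only bounds it. *)
pose D := ex_minn exD; have [HD minD] : (run_goal <= lrun bs D)%N /\
    forall d, (run_goal <= lrun bs d)%N -> (D <= d)%N.
  by rewrite /D; case: ex_minnP.
have runD := leq_trans HD (lrun_le x D).
exists D; split=> //; first exact: leq_trans (minD _ HD') leD'.
clearbody D; pose U := (Num.truncn (D%:R / eps x) + D)%N.
pose s0 := initial x.
have Q0 : 0 <= 2 / delta x by rewrite divr_ge0 // ltW.
(* The time bound is left open: each phase contributes a summand, and the sum is compared with
   [work D] at the end. *)
apply: ends_le; last first.
apply: ends_seq; first exact: (count_groups_ok (s := s0)).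
move=> s1 F1 /= E3; rewrite -/s0 -/groups in E3.
apply: ends_seq; first by apply: (@log_size_ok _ s1 n); rewrite F1.1.
move=> s2 F2 /= E5; have G2 := frame_seq F1 F2.
apply: ends_seq.
  apply: (@scan_levels_ok _ s2 bs run_goal D) => //.
  - by move=> j; rewrite G2.1.
  - by move=> j; rewrite G2.2.
  - by rewrite F2.1 // E3 E5.
  - by move=> a Ha; rewrite G2.1 //; do 10?[case: a Ha => [|a] Ha].
  - by rewrite G2.2.
  - move=> d Hd; rewrite ltnNge; apply/negP => /minD; lia.
move=> s3 F3 [E6 HC]; have G3 := frame_seq G2 F3.
apply: ends_seq.
  by apply: (@round_budget_ok _ s3 D (eps x)) => //; [rewrite G3.2|rewrite G3.1].
move=> s4 F4 /= E10; have G4 := frame_seq G3 F4.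
apply: ends_seq; first by apply: (@sort_chars_ok _ s4 n); rewrite G4.1.
move=> s5 F5 Hpi; have G5 := frame_seq G4 F5.
have [sg sg_inj [pi_sg pi_mono]] := rank_perm Hpi.
apply: ends_seq; first by apply: (@prefix_sums_ok _ s5 n); rewrite ?G5.1 ?G5.2.
move=> s6 F6 HS; have G6 := frame_seq G5 F6.
have E6' : iarr s6 6 0 = D by rewrite F6.1 // F5.1 // F4.1.
have E10' : iarr s6 10 0 = U by rewrite F6.1 // F5.1.
apply: ends_seq.
  by apply: (@round_sums_ok _ s6 n U) => // [|k]; rewrite G6.1.
move=> s7 F7; have G7 := frame_seq G6 F7; rewrite E6' !G6.2 // => Hrk.
pose M := (D + (n + n) + U + 1)%N.
apply: (@ends_seq _ _ _ _ (fun s => iarr s 19 0 = M)).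
  apply: ends_straight => //; rewrite /= /upd /= (F7.1 6) // E6' (F7.1 10) // E10'.
  by rewrite (G7.1 0).
move=> s8 F8 E19; have G8 := frame_seq G7 F8.
pose rk := iarr s7 16; pose S := rarr s7 4; pose C := rarr s7 3.
have cs8 : consts n D U M rk S C s8.
  split=> [|k|k|k]; [|by rewrite F8.1|by rewrite F8.2|by rewrite F8.2].
  split=> //; first by rewrite G8.1.
    by rewrite F8.1 // F7.1.
  by rewrite F8.1 // F7.1.
have M_gt : (D + (n + n) + U < M)%N by rewrite /M addn1.
apply: ends_seq.
  by apply: (@fill_table_ok _ n D U M rk S C M_gt) => // i; rewrite ?G8.1 ?G8.2.
move=> s9 F9 Ts; have cs9 := consts_frame F9 isT isT cs8; have G9 := frame_seq G8 F9.
pose F j := rarr s4 1 (iarr s5 14 j).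
have F_sg (i : 'I_n) : F i = (freq x (sg i))%:R.
  by rewrite /F pi_sg G4.2 // /= valK.
have S_F k : (k <= n)%N -> S k = \sum_(j < k) F j.
  move=> kn; rewrite /S F7.2 // HS //; apply: eq_bigr => j _.
  by rewrite /F F5.2.
have C_cost d : (d <= D)%N -> C d = lcost bs d.
  by move=> dD; rewrite /C F7.2 // F6.2 // F5.2 // F4.2 // HC.
pose Y := eps x * ((1 + delta x) * codelen x).
have rk_S k : (k <= n)%N -> rounded (S k * D%:R) Y U (rk k).
  by move=> kn; rewrite /S F7.2 //; apply: Hrk.
have n_lam := @up_logP 2 n isT.
have J_delta : 2 <= groups%:R * delta x.
  by rewrite -ler_pdivrMr // ltW // truncnS_gt.
have approx := @dp_approx R x adm (up_log 2 n) groups D U n_lam isT J_delta HD erefl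
  rk S C F sg S_F C_cost rk_S sg_inj F_sg pi_mono.
have Y0 : 0 <= Y.
  have cl : 0 <= codelen x by apply: le_trans (HT0.2).
  by rewrite mulr_ge0 ?mulr_ge0 ?addr_ge0 ?(ltW e0) ?(ltW d0).
have rk_Y k : (k <= n)%N -> (rk k <= U)%N -> S k * D%:R <= (rk k)%:R * Y.
  by move=> kn; case: (rk_S k kn).
apply: ends_seq.
  exact: (@trace_ok _ n D U M rk S C M_gt F Y Y0 S_F rk_Y s9 cs9 Ts (approx T0 HT0).1).
move=> s10 F10 W; have G10 := frame_seq G9 F10.
have [T [ET pT lenT decT]] := witness_tree adm n_lam (isT : (0 < groups)%N)
  J_delta HD erefl C_cost sg_inj F_sg W.
have Esz : (size (tree_code T)).+1 = n.*2.
  by rewrite size_tree_code (perm_size pT) size_enum_ord.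
apply: (@ends_le _ _ _ _ (300 * n.*2)) => //.
apply: (@ends_imp _ _ _ (fun s' => outputs s' T) _ (300 * (size (tree_code T)).+1)).
- move=> s' _ oT; exists T; split=> // T1 HT1; rewrite decT; exact: (approx T1 HT1).2.
- by rewrite Esz.
apply: emit_ok; rewrite ?G10.1 // ET.
rewrite -val_enum_ord -map_rev - !map_comp; apply: eq_map => i /=.
by rewrite /pair_val /= -pi_sg (F10.1 14) // F9.1 // F8.1 // F7.1 // F6.1.
(* Only arithmetic on times remains: [groups] and the logarithm are at most [D], the floor is at
   most [U], and the table size [Z] dominates every phase. *)
rewrite /work -/U [mcost _]/= -[(Num.truncn (2 / rarr s0 0 1)).+1]/groups.
set u := Num.truncn (D%:R / _) in U *.
have lJ : (groups <= D)%N by move: runD; rewrite /run_goal; lia.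
have ll : (up_log 2 n <= D)%N by move: runD; rewrite /run_goal; lia.
have le_u : (u <= U)%N by rewrite /U leq_addr.
clearbody U u; move: lJ ll le_u; generalize groups (up_log 2 n).
clear; move=> J lam lJ ll le_u.
set Z := (D.+2 * _)%N.
have Z1 : (D.+2 <= Z)%N by rewrite /Z leq_pmulr.
have Z2 : (n.+2 * U.+2 <= Z)%N by apply: leq_trans (leq_pmull _ _) (leq_pmull _ _).
have Z3 : (n.+1 * n.+1 <= Z)%N.
  apply: (@leq_trans (n.+2 * n.+2)); first by rewrite leq_mul.
  apply: leq_trans (leq_pmull _ _) => //.
  by rewrite leq_mul // leq_pmulr.
have Z4 : (n.+2 + U.+2 <= (n.+2 * U.+2).+1)%N by nia.
clearbody Z; rewrite -(mulnA 100%N n.+1) -(mulnA 100%N n.+2) -mul2n; lia.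
Qed.

End Program.

(** * Running time *)

Lemma up_log2_ln (R : realType) n : (1 < n)%N ->
  (up_log 2 n)%:R <= ln n%:R / ln 2 + 1 :> R.
Proof.
move=> n1; have l2 : 0 < ln 2 :> R by rewrite ln_gt0 // ltr1n.
have := up_log_gtn (isT : (1 < 2)%N) n1; have := up_log_gt0 2 n; rewrite n1.
case: (up_log 2 n) => // k _ /= Hk.
rewrite -natr1 lerD2r ler_pdivlMr // mulr_natl -lnXn // ler_ln ?posrE.
- by rewrite -natrX ler_nat ltnW.
- by rewrite exprn_gt0.
- by rewrite ltr0n ltnW.
Qed.

(** The parameters are bounded by [B] because the right side tends to 0 as [eps] or [delta] grows,
    while the work does not; at least two characters make the logarithm positive. *)
Lemma work_bound (R : realType) (N : nat) (B : R) : 0 < B ->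
  exists A : R, forall (x : instance R) D, admissible x ->
    (1 < nchars x)%N -> eps x <= B -> delta x <= B ->
    (run_goal x <= D)%N -> (D <= (hierarchies (bscheme x)).+1 * run_goal x)%N ->
    (N * work x D)%:R <= A * ((nchars x)%:R ^+ 2
      * (hierarchies (bscheme x))%:R ^+ 2 * ln (nchars x)%:R ^+ 2
      / (eps x * delta x ^+ 2)).
Proof.
(* The goal length is at most [2 / dl + c * l + 4]. Since [1 <= c * l] and [1 <= B / dl], the first
   term is at most [c * l * (2 / dl)] and the others at most [5 * (c * l * (B / dl))]. *)
move=> B0; pose c : R := (ln 2)^-1; pose a := c * (2 + 5 * B).
have l2 : 0 < ln 2 :> R by rewrite ln_gt0 // ltr1n.
have c0 : 0 < c by rewrite invr_gt0.
have a0 : 0 < a by rewrite mulr_gt0 //; lra.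
(* In 32, a factor 8 comes from doubling [D], [n] and [n] to absorb the added 2, and a factor 4 from
   squaring [k + 1 <= 2 * k]; [1 + 2 * B] absorbs the rounding surplus in [U + 2]. *)
exists (N%:R * 32 * (1 + 2 * B) * a ^+ 2).
move=> x D adm n1 eB dB Dlo Dhi; have [e0 d0 _ _ _] := adm.
set n := nchars x in n1 *; set k := hierarchies _ in Dhi *.
set l := ln n%:R; set ep := eps x in e0 eB *; set dl := delta x in d0 dB *.
have cl : 1 <= c * l.
  rewrite mulrC ler_pdivlMr // mul1r ler_ln ?posrE ?ler_nat //.
  by rewrite ltr0n ltnW.
have l0 : 0 < l by rewrite ln_gt0 // ltr1n.
have run_le : (run_goal x)%:R <= a * (l / dl).
  have id : 1 <= B / dl by rewrite ler_pdivlMr // mul1r.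
  have gl : (groups x)%:R <= 2 / dl + 1.
    by rewrite /groups -natr1 lerD2r truncn_le divr_ge0 // ltW.
  have ul := up_log2_ln R n1; rewrite -/l in ul.
  have i0 : 0 < dl^-1 by rewrite invr_gt0.
  have -> : a * (l / dl) = (c * l) * (2 * dl^-1) + 5 * (c * l * (B / dl)).
    by rewrite /a; ring.
  rewrite /run_goal !natrD -/n.
  have h1 : 2 * dl^-1 <= c * l * (2 * dl^-1) by rewrite ler_peMl // ltW ?mulr_gt0.
  have h2 : c * l <= c * l * (B / dl) by rewrite ler_peMr //; lra.
  rewrite (mulrC l) -/c in ul.
  lra.
have k1 : (1 <= k)%N by [].
set G := a * (l / dl) in run_le.
have G0 : 0 <= G by rewrite mulr_ge0 ?(ltW a0) // divr_ge0 // ltW.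
have D_le : D%:R <= 2 * k%:R * G.
  apply: (@le_trans _ _ (k.+1 * run_goal x)%:R); first by rewrite ler_nat.
  rewrite natrM; apply: ler_pM => //.
  by rewrite -natrM ler_nat mul2n -addnn -addn1 leq_add2l.
have D3 : (3 <= D)%N by apply: leq_trans Dlo; rewrite /run_goal /groups addSn addn2.
have U_le : (Num.truncn (D%:R / ep) + D).+2%:R <= (1 + 2 * B) * (D%:R / ep).
  have t1 : (Num.truncn (D%:R / ep))%:R <= D%:R / ep.
    by rewrite truncn_le divr_ge0 // ltW.
  have t2 : D%:R <= B * (D%:R / ep).
    by rewrite mulrCA ler_peMr // ler_pdivlMr // mul1r.
  have t3 : 2 <= D%:R :> R by rewrite ler_nat ltnW.
  by rewrite -2!natr1 natrD; lra.
have De0 : 0 <= D%:R / ep by rewrite divr_ge0 // ltW.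
rewrite natrM /work !natrM.
apply: (@le_trans _ _ (N%:R * (2 * D%:R * (2 * n%:R * (2 * n%:R
    * ((1 + 2 * B) * (D%:R / ep))))))).
  apply: ler_wpM2l => //.
  have hD : D.+2%:R <= 2 * D%:R :> R.
    by rewrite -natrM ler_nat mul2n -addnn -addn2 leq_add2l ltnW.
  have hn : n.+2%:R <= 2 * n%:R :> R.
    by rewrite -natrM ler_nat mul2n -addnn -addn2 leq_add2l.
  by do 3?[apply: ler_pM => //; rewrite ?mulr_ge0 //].
have -> : N%:R * (2 * D%:R * (2 * n%:R * (2 * n%:R * ((1 + 2 * B) * (D%:R / ep)))))
    = N%:R * 8 * (1 + 2 * B) * n%:R ^+ 2 / ep * D%:R ^+ 2 by ring.
have -> : N%:R * 32 * (1 + 2 * B) * a ^+ 2 *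
    (n%:R ^+ 2 * k%:R ^+ 2 * l ^+ 2 / (ep * dl ^+ 2))
    = N%:R * 8 * (1 + 2 * B) * n%:R ^+ 2 / ep * (2 * k%:R * G) ^+ 2.
  by rewrite /G; field; rewrite !gt_eqF.
apply: ler_wpM2l; last by rewrite ler_sqr ?nnegrE // mulr_ge0 // mulr_ge0.
by rewrite !mulr_ge0 ?sqr_ge0 ?invr_ge0 ?(ltW e0) // addr_ge0 // mulr_ge0 // ltW.
Qed.

Theorem theorem3 (R : realType) :
  exists P : program,
    [/\ forall (x : instance R) (D : R), admissible x -> is_DOPT x D ->
          exists (s : state R) (t : nat) (T : tree (nchars x)),
            [/\ exec P (initial x) s t,
                outputs s T,
                prefix_tree T,
                (len (freq x) T)%:R <= (1 + eps x) * (1 + delta x) * codelen x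
              & decode_time (bscheme x) (freq x) T <= (1 + delta x) * D],
        forall B : R, 0 < B ->
          exists A : R, forall (x : instance R) (s : state R) (t : nat),
            admissible x -> (1 < nchars x)%N -> eps x <= B -> delta x <= B ->
            exec P (initial x) s t ->
            t%:R <= A * ((nchars x)%:R ^+ 2 * (hierarchies (bscheme x))%:R ^+ 2
                           * ln (nchars x)%:R ^+ 2
                         / (eps x * delta x ^+ 2))
      & forall (k : nat) (B : R), 0 < B ->
          exists A : R, forall (x : instance R) (s : state R) (t : nat),
            admissible x -> hierarchies (bscheme x) = k ->
            (1 < nchars x)%N -> eps x <= B -> delta x <= B ->
            exec P (initial x) s t ->
            t%:R <= A * ((nchars x)%:R ^+ 2 * ln (nchars x)%:R ^+ 2
                         / (eps x * delta x ^+ 2))].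
Proof.
have time B : 0 < B -> exists A : R, forall (x : instance R) (s : state R) (t : nat),
    admissible x -> (1 < nchars x)%N -> eps x <= B -> delta x <= B ->
    exec decode_opt (initial x) s t ->
    t%:R <= A * ((nchars x)%:R ^+ 2 * (hierarchies (bscheme x))%:R ^+ 2
                   * ln (nchars x)%:R ^+ 2 / (eps x * delta x ^+ 2)).
  case/(work_bound 5000)=> A HA; exists A => x s t adm n1 eB dB Ex.
  have [D [Dlo Dhi [s' [t' [Ex' _ Ht]]]]] := decode_opt_ok adm.
  (* Determinism carries the bound from the run constructed above to the given one. *)
  have [_ ->] := exec_det Ex Ex'.
  by apply: le_trans (HA x D adm n1 eB dB Dlo Dhi); rewrite ler_nat.
exists decode_opt; split=> //.
- move=> x D adm [[T0 [fT0 <-]] _].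
  have [_ [_ _ [s [t [Ex [T [oT pT lT dT]] _]]]]] := decode_opt_ok adm.
  by exists s, t, T; split=> //; apply: dT.
- move=> k B /time[A HA]; exists (A * k%:R ^+ 2) => x s t adm <- n1 eB dB Ex.
  apply: le_trans (HA x s t adm n1 eB dB Ex) _; rewrite le_eqVlt; apply/orP; left.
  by apply/eqP; ring.
Qed.
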